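(* Let $q\in\mathbb{N}$ and let $H$ be a separable infinite-dimensional Hilbert space. If $R\in\mathcal{L}(H)$ satisfies the $q$-FHC Criterion, then the operator $C_R$, $C_R(S)=RSR^*$, is $q$-frequently hypercyclic on $(\mathcal{S}(H),\mathrm{COT})$.
   Context: $\mathcal{L}(H)$ is the space of bounded operators on $H$. $\mathcal{S}(H)$ is the real vector space of all self-adjoint operators in $\mathcal{L}(H)$, equipped with COT, the topology of uniform convergence on compact subsets of $H$; it is regarded as a real topological vector space. A continuous (real-)linear operator $A$ on a topological vector space $E$ is $q$-frequently hypercyclic if there is $x\in E$ such that for every non-empty open $V\subset E$ the set $M=\{n\in\mathbb{N}: A^nx\in V\}$ satisfies $\liminf_{N\to\infty}\frac{\mathrm{card}\{n\in M:\ n\le N^q\}}{N}>0$. $q$-FHC Criterion: a bounded operator $R$ on a separable Banach space $X$ satisfies the $q$-FHC Criterion if there is a dense set $D\subset X$ such that for each $x\in D$ there is a sequence $(x_n)_{n\ge0}$ in $X$ with $x_0=x$ and (a) $\sum_{n=0}^{r}R^{r^q-(r-n)^q}(x)$ converges unconditionally, uniformly in $r\ge0$; (b) $\sum_{n\ge0}x_{(n+r)^q-r^q}$ converges unconditionally, uniformly in $r\ge0$; (c) $R^{n^q}x_{n^q}=x$ and $R^{n^q}x_{m^q}=x_{m^q-n^q}$ for $m>n\ge0$. Here $\sum_n x_{n,r}$ converges unconditionally uniformly in $r$ if for every $\delta>0$ there is $N$ with $\|\sum_{n\in F}x_{n,r}\|<\delta$ for all finite $F\subset[N,\infty)$ and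 all $r$ (terms with $n>r$ are $0$ in the sums $\sum_{n=0}^r$). *)

(* Defs.v *)
From HB Require Import structures.
From mathcomp Require Import all_boot all_order all_algebra finmap complex.
From mathcomp Require Import ring lra.
From mathcomp Require Import all_classical all_reals all_analysis.

Set Implicit Arguments.
Unset Strict Implicit.
Unset Printing Implicit Defensive.

Import Order.TTheory GRing.Theory Num.Theory.
Import numFieldNormedType.Exports.

Local Open Scope classical_set_scope.
Local Open Scope ring_scope.

(* Hilbert spaces are taken over the reals or over the complex numbers. *)
Variant scalar_kind := RealScalars | ComplexScalars.

Definition scalars (R : realType) (k : scalar_kind) : numFieldType :=
  match k with RealScalars => R | ComplexScalars => R[i] end.

Definition scalar_conj {R : realType} {k : scalar_kind} :
    scalars R k -> scalars R k :=
  match k with RealScalars => idfun | ComplexScalars => @conjc R end.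

Definition real_scalar {R : realType} {k : scalar_kind} : R -> scalars R k :=
  match k with RealScalars => idfun | ComplexScalars => fun a => (a%:C)%C end.

Definition scalar_Re {R : realType} {k : scalar_kind} : scalars R k -> R :=
  match k with RealScalars => idfun | ComplexScalars => @complex.Re R end.

Section Scalars.
Variables (R : realType) (k : scalar_kind).
Local Notation K := (scalars R k).
Implicit Types (a b : R) (u v : K).

Lemma scalar_conjK : involutive (@scalar_conj R k).
Proof. by case: k => //= u; rewrite conjcK. Qed.

Lemma scalar_conjD u v : scalar_conj (u + v) = scalar_conj u + scalar_conj v.
Proof. by case: k u v => //= u v; rewrite rmorphD. Qed.

Lemma scalar_conjM u v : scalar_conj (u * v) = scalar_conj u * scalar_conj v.
Proof. by case: k u v => //= u v; rewrite rmorphM. Qed.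

Lemma scalar_mul_conj u : u * scalar_conj u = `|u| ^+ 2.
Proof.
by case: k u => /= u; [rewrite real_normK ?num_real// expr2|rewrite sqr_normc].
Qed.

Lemma scalar_norm_conj u : `|scalar_conj u| = `|u|.
Proof. by case: k u => //= u; rewrite normcJ. Qed.

Lemma scalar_conj_real a : scalar_conj (real_scalar a) = real_scalar a :> K.
Proof. by case: k => //=; exact: conjc_real. Qed.

Lemma real_scalar1 : real_scalar 1 = 1 :> K.
Proof. by case: k. Qed.

Lemma real_scalar0 : real_scalar 0 = 0 :> K.
Proof. by case: k. Qed.

Lemma real_scalarD a b : real_scalar (a + b) = real_scalar a + real_scalar b :> K.
Proof. by case: k => //=; rewrite rmorphD. Qed.

Lemma real_scalarM a b : real_scalar (a * b) = real_scalar a * real_scalar b :> K.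
Proof. by case: k => //=; rewrite rmorphM. Qed.

Lemma real_scalarB a b : real_scalar (a - b) = real_scalar a - real_scalar b :> K.
Proof. by case: k => //=; rewrite rmorphB. Qed.

Lemma real_scalar_le a b : (real_scalar a <= real_scalar b :> K) = (a <= b).
Proof. by case: k => //=; rewrite lecR. Qed.

Lemma real_scalar_lt a b : (real_scalar a < real_scalar b :> K) = (a < b).
Proof. by case: k => //=; rewrite ltcR. Qed.

Lemma real_scalar_norm a : `|real_scalar a : K| = real_scalar `|a|.
Proof. by case: k => //=; rewrite normc_def/= expr0n/= addr0 sqrtr_sqr. Qed.

Lemma scalar_ReD u v : scalar_Re (u + v) = scalar_Re u + scalar_Re v.
Proof. by case: k u v => //= -[a b] [c d]. Qed.

Lemma scalar_ReN u : scalar_Re (- u) = - scalar_Re u.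
Proof. by case: k u => //= -[a b]. Qed.

Lemma scalar_Re_real a : scalar_Re (real_scalar a : K) = a.
Proof. by case: k. Qed.

Lemma scalar_ReZ a u : scalar_Re (real_scalar a * u) = a * scalar_Re u.
Proof. by case: k u => //= -[b c] /=; rewrite mul0r subr0. Qed.

Lemma scalar_Re_conj u : scalar_Re (scalar_conj u) = scalar_Re u.
Proof. by case: k u => //= -[]. Qed.

Lemma scalar_Re_ge0 u : 0 <= u -> real_scalar (scalar_Re u) = u.
Proof. by case: k u => //= u u0; rewrite RRe_real// ger0_real. Qed.

Lemma scalar_Re_le u : real_scalar `|scalar_Re u| <= `|u|.
Proof. by case: k u => //= u; exact: normc_ge_Re. Qed.

End Scalars.

HB.mixin Record CompleteNormedModule_isHilbert (R : realType) (k : scalar_kind)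
    H & CompleteNormedModule (scalars R k) H := {
  inner : {dot H for @scalar_conj R k} ;
  inner_norm : forall x : H, inner x x = `|x| ^+ 2
}.

#[short(type="hilbertType")]
HB.structure Definition Hilbert (R : realType) (k : scalar_kind) :=
  {H of CompleteNormedModule_isHilbert R k H
      & CompleteNormedModule (scalars R k) H}.

Section HilbertTheory.
Variables (R : realType) (k : scalar_kind) (H : hilbertType R k).
Implicit Types x y z : H.

Lemma innerDl x y z : inner (x + y) z = inner x z + inner y z.
Proof. by rewrite linearDl. Qed.

Lemma innerZl a x z : inner (a *: x) z = a * inner x z.
Proof. by rewrite linearZl. Qed.

Lemma innerDr x y z : inner z (x + y) = inner z x + inner z y.
Proof. by rewrite raddfD. Qed.

Lemma innerZr a x z : inner z (a *: x) = scalar_conj a * inner z x.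
Proof. by rewrite linearZr. Qed.

Lemma innerC x y : inner x y = scalar_conj (inner y x).
Proof. by rewrite hermitian_subproof expr0 mul1r. Qed.

Lemma innerNl x z : inner (- x) z = - inner x z.
Proof. by rewrite -scaleN1r innerZl mulN1r. Qed.

Lemma innerNr x z : inner z (- x) = - inner z x.
Proof. by rewrite raddfN. Qed.

Lemma inner_inj x y : (forall z, inner z x = inner z y) -> x = y.
Proof.
move=> xy; apply/eqP; rewrite -subr_eq0 -normr_eq0 -sqrf_eq0 -inner_norm.
by rewrite innerDr innerNr xy subrr.
Qed.

Definition rnorm x : R := scalar_Re `|x|.

Lemma real_rnorm x : real_scalar (rnorm x) = `|x|.
Proof. by rewrite scalar_Re_ge0. Qed.

Lemma rnorm_ge0 x : 0 <= rnorm x.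
Proof.
by rewrite -(real_scalar_le k) real_rnorm real_scalar0.
Qed.

Lemma Re_innerxx x : scalar_Re (inner x x) = rnorm x ^+ 2.
Proof.
by rewrite inner_norm -real_rnorm !expr2 -real_scalarM scalar_Re_real.
Qed.

Lemma rnormD2 x y :
  rnorm (x + y) ^+ 2 = rnorm x ^+ 2 + rnorm y ^+ 2 + 2 * scalar_Re (inner y x).
Proof.
rewrite -!Re_innerxx !(innerDl, innerDr) (innerC x y) !scalar_ReD.
by rewrite scalar_Re_conj; ring.
Qed.

Lemma rnormZ a x : rnorm (real_scalar a *: x) = `|a| * rnorm x.
Proof. by rewrite /rnorm normrZ real_scalar_norm scalar_ReZ. Qed.

Lemma Re_inner_le x y : scalar_Re (inner x y) <= rnorm x * rnorm y.
Proof.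
have [x0|x0] := eqVneq (rnorm x) 0.
  have /eqP : `|x| = 0 by rewrite -real_rnorm x0 real_scalar0.
  rewrite normr_eq0 => /eqP ->; rewrite -(scale0r 0) innerZl mul0r.
  by rewrite -(real_scalar0 R k) scalar_Re_real mulr_ge0// rnorm_ge0.
have x1 : 0 < rnorm x by rewrite lt_def x0 rnorm_ge0.
have := sqr_ge0 (rnorm (y + real_scalar (- (rnorm y / rnorm x)) *: x)).
rewrite rnormD2 rnormZ innerZl scalar_ReZ normrN ger0_norm; last first.
  by rewrite divr_ge0 ?rnorm_ge0.
rewrite divfK//.
have [y0|y0] := eqVneq (rnorm y) 0.
  have /eqP : `|y| = 0 by rewrite -real_rnorm y0 real_scalar0.
  rewrite normr_eq0 => /eqP -> _; rewrite raddf0.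
  by rewrite -(real_scalar0 R k) scalar_Re_real mulr_ge0// rnorm_ge0.
have y1 : 0 < rnorm y by rewrite lt_def y0 rnorm_ge0.
set s := scalar_Re _ => h.
have {}h : rnorm y / rnorm x * s <= rnorm y ^+ 2 by nra.
have : (rnorm x)^-1 * s <= rnorm y.
  by rewrite -(ler_pM2l y1) mulrA -expr2.
by rewrite ler_pdivrMl.
Qed.

Lemma inner_le x y : `|inner x y| <= `|x| * `|y|.
Proof.
set u := inner x y.
have [->|u0] := eqVneq u 0; first by rewrite normr0 mulr_ge0.
have := Re_inner_le (scalar_conj u *: x) y.
rewrite innerZl -/u mulrC scalar_mul_conj -(real_scalar_le k).
rewrite scalar_Re_ge0 ?exprn_ge0// real_scalarM !real_rnorm normrZ.
by rewrite scalar_norm_conj expr2 -mulrA ler_pM2l// normr_gt0.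
Qed.

End HilbertTheory.

Section Riesz.
Variables (R : realType) (k : scalar_kind) (H : hilbertType R k).
Local Notation K := (scalars R k).
Variables (f : {scalar H}) (M : K).
Hypothesis fM : forall x, `|f x| <= M * `|x|.
Implicit Types x y z h : H.

Let J x : R := rnorm x ^+ 2 - 2 * scalar_Re (f x).
Let m := scalar_Re `|M|.

Let Ref x : scalar_Re (f x) <= m * rnorm x.
Proof.
rewrite (le_trans (ler_norm _))// -(real_scalar_le k).
rewrite (le_trans (scalar_Re_le _))// (le_trans (fM x))// real_scalarM.
have [->|x0] := eqVneq x 0; first by rewrite real_rnorm normr0 !mulr0.
rewrite real_rnorm /m scalar_Re_ge0// ler_pM2r ?normr_gt0//.
suff M0 : 0 <= M by rewrite ger0_norm.
by rewrite -(pmulr_lge0 _ (_ : 0 < `|x|)) ?normr_gt0// (le_trans _ (fM x)).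
Qed.

Let J_ge x : - m ^+ 2 <= J x.
Proof.
have h1 := Ref x; have h2 := sqr_ge0 (rnorm x - m); rewrite /J; nra.
Qed.

Let J_inf : has_inf (range J).
Proof. by split; [exists (J 0), 0|exists (- m ^+ 2) => _ [x _ <-]]. Qed.

Let m0 := inf (range J).

Let m0_le x : m0 <= J x.
Proof. by apply: ge_inf; [case: J_inf|exists x]. Qed.

Let J_adh (e : R) : 0 < e -> exists x, J x < m0 + e.
Proof. by move=> /inf_adherent /(_ J_inf) [_ [x _ <-]]; exists x. Qed.

Let J_para x y : J (x + y) + J (x - y) = 2 * J x + 2 * rnorm y ^+ 2.
Proof.
rewrite /J !rnormD2 !raddfD/= !raddfN/= !innerNl !scalar_ReD !scalar_ReN.
rewrite (_ : rnorm (- y) = rnorm y); first by ring.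
by rewrite /rnorm normrN.
Qed.

Let J_close (e : R) x y : J x < m0 + e -> J y < m0 + e ->
  rnorm (x - y) ^+ 2 <= 4 * e.
Proof.
move=> Jx Jy; pose c : R := 2^-1.
pose w := real_scalar c *: (x + y); pose v := real_scalar c *: (x - y).
have half z : real_scalar c *: z + real_scalar c *: z = z.
  rewrite -scalerDl -real_scalarD (_ : c + c = 1) ?real_scalar1 ?scale1r//.
  by rewrite /c; lra.
have xE : x = w + v.
  by rewrite /w /v !scalerDr scalerN addrACA subrr addr0 half.
have yE : y = w - v.
  by rewrite /w /v !scalerDr scalerN opprD opprK addrACA subrr add0r half.
have := J_para w v; rewrite -xE -yE => JE.
have -> : x - y = v + v by rewrite /v half.
have := m0_le w.
rewrite rnormD2 Re_innerxx; lra.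
Qed.

Let F : set_system H := filter_from [set e : R | 0 < e] (fun e => [set x | J x < m0 + e]).

Let F_filter : ProperFilter F.
Proof.
apply: filter_from_proper; last first.
  by move=> e /J_adh [x Jx]; exists x.
apply: filter_from_filter; first by exists 1 => /=.
move=> e e' /= e0 e'0; exists (Num.min e e') => /=; first by rewrite lt_min e0.
move=> x /= Jx; split; apply: (lt_le_trans Jx); rewrite lerD2l.
  by rewrite ge_min lexx.
by rewrite ge_min lexx orbT.
Qed.

Let F_cauchy : cauchy F.
Proof.
have FF := F_filter; apply/cauchy_ballP => e e0.
have eE := scalar_Re_ge0 (ltW e0); set d := scalar_Re e in eE.
have d0 : 0 < d by rewrite -(real_scalar_lt k) eE real_scalar0.
have d1 : 0 < d ^+ 2 / 8 by rewrite divr_gt0// exprn_gt0.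
exists ([set x | J x < m0 + d ^+ 2 / 8], [set x | J x < m0 + d ^+ 2 / 8]).
  by split; exists (d ^+ 2 / 8).
move=> [x y] [/= Jx Jy]; rewrite -ball_normE /ball_/= -eE -real_rnorm.
rewrite real_scalar_lt -(ltr_pXn2r (_ : 0 < 2)%N) ?nnegrE ?rnorm_ge0 ?ltW//.
rewrite (le_lt_trans (J_close Jx Jy))//; have : 0 < d ^+ 2 by rewrite exprn_gt0.
lra.
Qed.

Lemma riesz : exists z, forall x, f x = inner x z.
Proof.
have FF := F_filter; have [z Fz] : exists z, F --> z.
  by apply/cvg_ex; exact: cauchy_cvg.
exists z => x0.
have close (e d : R) : 0 < e -> 0 < d ->
    exists2 x, J x < m0 + e & rnorm (z - x) < d.
  move=> e0 d0.
  have [x [Jx zx]] : [set x | J x < m0 + e] `&` ball z (real_scalar d) !=set0.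
    apply: (@filter_ex _ F); apply: filterI; first by exists e.
    by apply: Fz; apply: nbhsx_ballx; rewrite -(real_scalar0 R k) real_scalar_lt.
  exists x => //; move: zx; rewrite -ball_normE /ball_/= -real_rnorm.
  by rewrite real_scalar_lt.
have Re0 h : scalar_Re (inner h z) = scalar_Re (f h).
  pose g x := scalar_Re (inner h x) - scalar_Re (f h).
  suff : g z = 0 by rewrite /g; lra.
  have quad t : 0 <= t ^+ 2 * rnorm h ^+ 2 + 2 * (t * g z).
    apply/ler_addgt0Pr => e e0; set G := g z.
    have d0 : 0 < (e / 2) / (2 * `|t| * rnorm h + 1).
      by rewrite divr_gt0 ?divr_gt0// ltr_wpDl// !mulr_ge0// rnorm_ge0.
    have e20 : 0 < e / 2 by rewrite divr_gt0.
    have [x Jx zx] := close _ _ e20 d0.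
    have := m0_le (x + real_scalar t *: h).
    have fE : f (x + real_scalar t *: h) = f x + real_scalar t * f h.
      by rewrite raddfD/= linearZ.
    rewrite {1}/J rnormD2 fE !innerZl !scalar_ReD !scalar_ReZ.
    rewrite rnormZ exprMn real_normK ?num_real//.
    have -> : rnorm x ^+ 2 = J x + 2 * scalar_Re (f x) by rewrite /J; lra.
    have gxE : scalar_Re (inner h x) = g x + scalar_Re (f h) by rewrite /g; lra.
    rewrite gxE => q.
    have gx : t * (g x - G) <= `|t| * (rnorm h * rnorm (z - x)).
      rewrite (le_trans (ler_norm _))// normrM ler_wpM2l//.
      have -> : g x - G = scalar_Re (inner h (x - z)).
        by rewrite /G /g innerDr innerNr scalar_ReD scalar_ReN; lra.
      rewrite ler_norml; apply/andP; split.
        rewrite lerNl -scalar_ReN -innerNr opprB; exact: Re_inner_le.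
      rewrite (le_trans (Re_inner_le _ _))//.
      by rewrite (_ : rnorm (x - z) = rnorm (z - x))// /rnorm distrC.
    move: zx; rewrite ltr_pdivlMr; last first.
      by rewrite ltr_wpDl// !mulr_ge0// rnorm_ge0.
    have := rnorm_ge0 (z - x).
    move: (rnorm (z - x)) gx => D gx D0 zx.
    nra.
  have n0 := sqr_ge0 (rnorm h); set n := rnorm h ^+ 2 in n0 quad.
  apply/eqP; rewrite -sqrf_eq0; apply/eqP/le_anti; rewrite sqr_ge0 andbT.
  have n1 : 0 < n + 1 by rewrite ltr_wpDl.
  have := quad (- (g z / (n + 1))); rewrite sqrrN.
  rewrite -(pmulr_rge0 _ (exprn_gt0 2 n1)).
  have -> : (n + 1) ^+ 2 * ((g z / (n + 1)) ^+ 2 * n +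
     2 * (- (g z / (n + 1)) * g z)) = - ((g z) ^+ 2 * (n + 2)).
    by field; rewrite gt_eqF.
  by have := sqr_ge0 (g z); nra.
apply/eqP; rewrite eq_sym -subr_eq0; set u := _ - _.
rewrite -normr_eq0 -sqrf_eq0 -scalar_mul_conj mulrC.
have u0 : scalar_Re (scalar_conj u * u) = 0.
  rewrite /u mulrBr -innerZl -linearZ/= scalar_ReD scalar_ReN Re0.
  by rewrite subrr.
rewrite -(scalar_Re_ge0 (_ : 0 <= scalar_conj u * u)) ?u0 ?real_scalar0//.
by rewrite mulrC scalar_mul_conj exprn_ge0.
Qed.

End Riesz.

Section BoundedOperators.
Variables (R : realType) (k : scalar_kind) (H : hilbertType R k).
Local Notation K := (scalars R k).

Record bounded_operator := BoundedOperator {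
  bop_fun :> H -> H ;
  bop_linear : linear bop_fun ;
  bop_bounded : exists M : K, forall x, `|bop_fun x| <= M * `|x|
}.

HB.instance Definition _ (T : bounded_operator) :=
  GRing.isLinear.Build K H H *:%R (bop_fun T) (bop_linear T).
HB.instance Definition _ := gen_eqMixin bounded_operator.
HB.instance Definition _ := gen_choiceMixin bounded_operator.

Implicit Types (S T U : bounded_operator) (a : K) (x y : H).

Lemma bopP S T : S =1 T -> S = T.
Proof.
move=> /funext; case: S => f lf bf; case: T => g lg bg /= fg.
by case: _ / fg lg bg => *; congr BoundedOperator; exact: Prop_irrelevance.
Qed.

Lemma bop_ge0_bounded T :
  exists2 M : R, 0 <= M & forall x, `|T x| <= real_scalar M * `|x|.
Proof.
have [M TM] := bop_bounded T; exists (scalar_Re `|M|) => [|x].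
  by rewrite -(real_scalar_le k) scalar_Re_ge0// real_scalar0.
rewrite (le_trans (TM x))// scalar_Re_ge0//.
have [->|x0] := eqVneq x 0; first by rewrite normr0 !mulr0.
rewrite ler_pM2r ?normr_gt0//.
suff M0 : 0 <= M by rewrite ger0_norm.
by rewrite -(pmulr_lge0 _ (_ : 0 < `|x|)) ?normr_gt0// (le_trans _ (TM x)).
Qed.

Program Definition bop_zero := @BoundedOperator (fun=> 0) _ _.
Next Obligation. by move=> a x y; rewrite scaler0 addr0. Qed.
Next Obligation. by exists 0 => x; rewrite normr0 mul0r. Qed.

Program Definition bop_add S T := @BoundedOperator (fun x => S x + T x) _ _.
Next Obligation.
by move=> S T a x y; rewrite !linearP scalerDr addrACA.
Qed.
Next Obligation.
move=> S T; have [M _ SM] := bop_ge0_bounded S.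
have [N _ TN] := bop_ge0_bounded T.
exists (real_scalar M + real_scalar N) => x.
by rewrite mulrDl (le_trans (ler_normD _ _))// lerD.
Qed.

Program Definition bop_scale a T := @BoundedOperator (fun x => a *: T x) _ _.
Next Obligation.
by move=> a T b x y; rewrite linearP scalerDr !scalerA mulrC.
Qed.
Next Obligation.
move=> a T; have [M _ TM] := bop_ge0_bounded T.
by exists (`|a| * real_scalar M) => x; rewrite normrZ -mulrA ler_wpM2l.
Qed.

Let bop_addA : associative bop_add.
Proof. by move=> S T U; apply: bopP => x /=; rewrite addrA. Qed.
Let bop_addC : commutative bop_add.
Proof. by move=> S T; apply: bopP => x /=; rewrite addrC. Qed.
Let bop_add0 : left_id bop_zero bop_add.
Proof. by move=> S; apply: bopP => x /=; rewrite add0r. Qed.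
Let bop_addN : left_inverse bop_zero (bop_scale (-1)) bop_add.
Proof. by move=> S; apply: bopP => x /=; rewrite scaleN1r addNr. Qed.

HB.instance Definition _ :=
  GRing.isZmodule.Build bounded_operator bop_addA bop_addC bop_add0 bop_addN.

Let bop_scaleA a b T : bop_scale a (bop_scale b T) = bop_scale (a * b) T.
Proof. by apply: bopP => x /=; rewrite scalerA. Qed.
Let bop_scale1 : left_id 1 bop_scale.
Proof. by move=> S; apply: bopP => x /=; rewrite scale1r. Qed.
Let bop_scaleDr : right_distributive bop_scale +%R.
Proof. by move=> a S T; apply: bopP => x /=; rewrite scalerDr. Qed.
Let bop_scaleDl T : {morph bop_scale^~ T : a b / a + b}.
Proof. by move=> a b; apply: bopP => x /=; rewrite scalerDl. Qed.

HB.instance Definition _ :=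
  GRing.Zmodule_isLmodule.Build K bounded_operator
    bop_scaleA bop_scale1 bop_scaleDr bop_scaleDl.

Program Definition bop_comp S T := @BoundedOperator (S \o T) _ _.
Next Obligation. by move=> S T a x y; rewrite /= !linearP. Qed.
Next Obligation.
move=> S T; have [M M0 SM] := bop_ge0_bounded S.
have [N _ TN] := bop_ge0_bounded T.
exists (real_scalar M * real_scalar N) => x /=.
rewrite (le_trans (SM _))// -mulrA ler_wpM2l//.
by rewrite -(real_scalar0 R k) real_scalar_le.
Qed.

Lemma adjoint_subproof T y : exists z, forall x, inner (T x) y = inner x z.
Proof.
have lf : scalar (fun x => inner (T x) y).
  by move=> a u v; rewrite linearP innerDl innerZl.
pose f : {scalar H} :=
  HB.pack (fun x => inner (T x) y) (GRing.isLinear.Build _ _ _ _ _ lf).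
have [M M0 TM] := bop_ge0_bounded T.
apply: (@riesz _ _ _ f (real_scalar M * `|y|)) => x /=.
by rewrite (le_trans (inner_le _ _))// mulrAC ler_wpM2r.
Qed.

Definition adjoint_fun T y : H := projT1 (cid (adjoint_subproof T y)).

Lemma adjoint_funP T x y : inner (T x) y = inner x (adjoint_fun T y).
Proof. by rewrite /adjoint_fun; case: cid. Qed.

Program Definition adjoint T := @BoundedOperator (adjoint_fun T) _ _.
Next Obligation.
move=> T a x y; apply: inner_inj => z.
by rewrite innerDr innerZr -!adjoint_funP innerDr innerZr.
Qed.
Next Obligation.
move=> T; have [M M0 TM] := bop_ge0_bounded T.
exists (real_scalar M) => y; have [->|y0] := eqVneq (adjoint_fun T y) 0.
  by rewrite normr0 mulr_ge0// -(real_scalar0 R k) real_scalar_le.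
rewrite -(ler_pM2l (_ : 0 < `|adjoint_fun T y|)) ?normr_gt0//.
rewrite -expr2 -inner_norm -adjoint_funP.
rewrite -[leLHS]ger0_norm ?adjoint_funP ?inner_norm ?exprn_ge0//.
rewrite -inner_norm -adjoint_funP (le_trans (inner_le _ _))//.
by rewrite mulrA [_ * real_scalar M]mulrC ler_wpM2r.
Qed.

Lemma adjointP T x y : inner (T x) y = inner x (adjoint T y).
Proof. exact: adjoint_funP. Qed.

Lemma adjoint_unique S T :
  (forall x y, inner (T x) y = inner x (S y)) -> adjoint T = S.
Proof.
by move=> ST; apply: bopP => y; apply: inner_inj => x; rewrite -adjointP ST.
Qed.

Lemma adjointK : involutive adjoint.
Proof.
move=> T; apply: adjoint_unique => x y.
by rewrite innerC -adjointP -innerC.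
Qed.

End BoundedOperators.

Section SelfAdjoint.
Variables (R : realType) (k : scalar_kind) (H : hilbertType R k).
Local Notation K := (scalars R k).

Record selfadjoint := SelfAdjoint {
  sa_op :> bounded_operator H ;
  sa_opP : adjoint sa_op = sa_op
}.

HB.instance Definition _ := gen_eqMixin selfadjoint.
HB.instance Definition _ := gen_choiceMixin selfadjoint.

Implicit Types (S T U : selfadjoint) (a b : R) (x y : H).

Lemma selfadjointP S T : S =1 T -> S = T.
Proof.
move=> /bopP; case: S => f f1; case: T => g g1 /= fg.
by case: _ / fg g1 => *; congr SelfAdjoint; exact: Prop_irrelevance.
Qed.

Lemma selfadjointE S x y : inner (S x) y = inner x (S y).
Proof. by rewrite adjointP sa_opP. Qed.

Program Definition sa_zero := @SelfAdjoint 0 _.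
Next Obligation.
by apply: adjoint_unique => x y /=; rewrite raddf0 linear0l.
Qed.

Program Definition sa_add S T :=
  @SelfAdjoint ((S : bounded_operator H) + (T : bounded_operator H)) _.
Next Obligation.
move=> S T; apply: adjoint_unique => x y /=.
by rewrite innerDl innerDr !selfadjointE.
Qed.

Program Definition sa_scale a T :=
  @SelfAdjoint ((real_scalar a : K) *: (T : bounded_operator H)) _.
Next Obligation.
move=> a T; apply: adjoint_unique => x y /=.
by rewrite innerZl innerZr scalar_conj_real selfadjointE.
Qed.

Let sa_addA : associative sa_add.
Proof. by move=> S T U; apply: selfadjointP => x /=; rewrite addrA. Qed.
Let sa_addC : commutative sa_add.
Proof. by move=> S T; apply: selfadjointP => x /=; rewrite addrC. Qed.
Let sa_add0 : left_id sa_zero sa_add.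
Proof. by move=> S; apply: selfadjointP => x /=; rewrite add0r. Qed.
Let sa_addN : left_inverse sa_zero (sa_scale (-1)) sa_add.
Proof.
move=> S; apply: selfadjointP => x /=.
by rewrite -[- 1]sub0r real_scalarB real_scalar0 real_scalar1 sub0r scaleN1r addNr.
Qed.

HB.instance Definition _ :=
  GRing.isZmodule.Build selfadjoint sa_addA sa_addC sa_add0 sa_addN.

Let sa_scaleA a b T : sa_scale a (sa_scale b T) = sa_scale (a * b) T.
Proof. by apply: selfadjointP => x /=; rewrite scalerA real_scalarM. Qed.
Let sa_scale1 : left_id 1 sa_scale.
Proof.
by move=> S; apply: selfadjointP => x /=; rewrite real_scalar1 scale1r.
Qed.
Let sa_scaleDr : right_distributive sa_scale +%R.
Proof. by move=> a S T; apply: selfadjointP => x /=; rewrite scalerDr. Qed.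
Let sa_scaleDl T : {morph sa_scale^~ T : a b / a + b}.
Proof.
by move=> a b; apply: selfadjointP => x /=; rewrite real_scalarD scalerDl.
Qed.

HB.instance Definition _ :=
  GRing.Zmodule_isLmodule.Build R selfadjoint
    sa_scaleA sa_scale1 sa_scaleDr sa_scaleDl.

(* The topology of uniform convergence on compact subsets of H. *)
HB.instance Definition _ := Topological.copy selfadjoint
  (initial_topology
    (fun S : selfadjoint => (S : H -> H) : {family compact, H -> H})).

Lemma cot_nbhs S (A : set H) (e : R) : compact A -> 0 < e ->
  nbhs S [set T : selfadjoint | forall y, A y -> `|S y - T y| < real_scalar e].
Proof.
move=> cA e0.
pose w (T : selfadjoint) : {family compact, H -> H} := T : H -> H.
pose E := [set xy : H * H | `|xy.1 - xy.2| < real_scalar e].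
have entE : entourage E.
  rewrite -entourage_ballE; exists (real_scalar e) => /=.
    by rewrite -(real_scalar0 R k) real_scalar_lt.
  by move=> [x y] /=; rewrite -ball_normE.
exact: (@initial_continuous _ _ w S _ (fam_nbhs (w S) entE cA)).
Qed.

Lemma cot_continuous (X : topologicalType) (f : X -> selfadjoint) :
  (forall p (A : set H) (e : R), compact A -> 0 < e ->
     \forall q \near p, forall y, A y -> `|f p y - f q y| < real_scalar e) ->
  continuous f.
Proof.
move=> h; apply: continuous_comp_initial => p.
apply/fam_cvgP => A cA P /uniform_nbhs[E []]; rewrite -entourage_ballE => -[e /= e0 eE] EP.
rewrite /= nbhs_simpl/=.
have eRe := scalar_Re_ge0 (ltW e0).
have Re0 : 0 < scalar_Re e by rewrite -(real_scalar_lt k) eRe real_scalar0.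
apply: filterS (h p A _ cA Re0) => q pq; apply: EP => y Ay; apply: eE => /=.
by rewrite -ball_normE /ball_/= -eRe; exact: pq.
Qed.

Lemma compact_rnorm (A : set H) :
  compact A -> exists2 M : R, 0 < M & forall x, A x -> rnorm x < M.
Proof.
move=> /compact_near_coveringP cA.
have : \forall M \near +oo, A `<=` (fun x => rnorm x < M).
  apply: (cA R +oo (fun M x => rnorm x < M)) => x Ax.
  exists (ball x 1, [set M | rnorm x + 1 < M]).
    split => /=; first exact: nbhsx_ballx.
    by apply: nbhs_pinfty_gt; rewrite num_real.
  move=> [y M] [/=]; rewrite -ball_normE /ball_/= => xy; apply: le_lt_trans.
  rewrite -(real_scalar_le k) real_scalarD !real_rnorm real_scalar1 -lerBlDl.
  by rewrite (le_trans (lerB_dist _ _))// distrC ltW.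
move=> [M [_ AM]]; exists (Num.max M 0 + 1); first by rewrite ltr_wpDl// le_max lexx orbT.
by apply: AM; rewrite (@le_lt_trans _ _ (Num.max M 0)) ?le_max ?lexx// ltrDl.
Qed.

Let sa_add_continuous : continuous (fun x : selfadjoint * selfadjoint => x.1 + x.2).
Proof.
apply: cot_continuous => -[S T] A e cA e0 /=.
have e20 : 0 < e / 2 by rewrite divr_gt0.
exists ([set S' : selfadjoint | forall y, A y -> `|S y - S' y| < real_scalar (e / 2)],
        [set T' : selfadjoint | forall y, A y -> `|T y - T' y| < real_scalar (e / 2)]).
  by split; exact: cot_nbhs.
move=> [S' T'] [/= SS' TT'] y Ay.
rewrite opprD addrACA (le_lt_trans (ler_normD _ _))//.
rewrite (_ : e = e / 2 + e / 2) ?real_scalarD ?ltrD ?SS' ?TT'//.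
by rewrite -splitr.
Qed.

Let sa_scale_continuous :
  continuous (fun z : R^o * selfadjoint => z.1 *: z.2).
Proof.
apply: cot_continuous => -[a S] A e cA e0 /=.
have [M M0 AM] := compact_rnorm cA; have [N N0 SN] := bop_ge0_bounded S.
have a0 : 0 < `|a| + 1 by rewrite ltr_wpDl.
have NM0 : 0 < N * M + 1 by rewrite ltr_wpDl// mulr_ge0// ltW.
have d0 : 0 < e / 2 / (`|a| + 1) by rewrite !divr_gt0.
have d1 : 0 < Num.min 1 (e / 2 / (N * M + 1)) by rewrite lt_min ltr01 !divr_gt0.
exists (ball (a : R^o) (Num.min 1 (e / 2 / (N * M + 1))),
    [set T : selfadjoint |
      forall y, A y -> `|S y - T y| < real_scalar (e / 2 / (`|a| + 1))]).
  by split; [exact: nbhsx_ballx|exact: cot_nbhs].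
move=> [b T] [/= ab ST] y Ay.
move: ab; rewrite -ball_normE /ball_/= lt_min => /andP[ab1 ab].
rewrite (_ : _ - _ = real_scalar (a - b) *: S y + real_scalar b *: (S y - T y));
  last by rewrite real_scalarB scalerBl scalerBr addrA subrK.
rewrite (le_lt_trans (ler_normD _ _))// !normrZ !real_scalar_norm.
have Sy : `|S y| <= real_scalar (N * M).
  rewrite (le_trans (SN y))// real_scalarM ler_wpM2l//.
    by rewrite -(real_scalar0 R k) real_scalar_le.
  by rewrite -real_rnorm real_scalar_le ltW// AM.
have ba : `|b| <= `|a| + 1.
  by rewrite -lerBlDl (le_trans (lerB_dist _ _))// distrC ltW.
rewrite (splitr e) real_scalarD ler_ltD//.
  rewrite (@le_trans _ _ (real_scalar `|a - b| * real_scalar (N * M)))//.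
    by rewrite ler_wpM2l// -(real_scalar0 R k) real_scalar_le.
  rewrite -real_scalarM real_scalar_le.
  move: ab; rewrite ltr_pdivlMr// => /ltW; apply: le_trans.
  by rewrite ler_wpM2l// lerDl.
rewrite (@le_lt_trans _ _ (real_scalar (`|a| + 1) * `|S y - T y|))//.
  by rewrite ler_wpM2r// real_scalar_le.
rewrite -real_rnorm -real_scalarM real_scalar_lt mulrC -ltr_pdivlMr//.
by rewrite -(real_scalar_lt k) real_rnorm; exact: ST.
Qed.

HB.instance Definition _ :=
  PreTopologicalNmodule_isTopologicalNmodule.Build selfadjoint sa_add_continuous.
HB.instance Definition _ :=
  TopologicalNmodule_isTopologicalLmodule.Build R selfadjoint sa_scale_continuous.

End SelfAdjoint.


Section ConjugationOperator.
Variables (R : realType) (k : scalar_kind) (H : hilbertType R k).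

(* C_T : S |-> T S T^* *)
Program Definition conjugation (T : bounded_operator H) (S : selfadjoint H) :
    selfadjoint H :=
  @SelfAdjoint _ _ _ (bop_comp (bop_comp T S) (adjoint T)) _.
Next Obligation.
move=> T S; apply: adjoint_unique => x y.
rewrite -[LHS]/(inner (T (S (adjoint T x))) y) adjointP selfadjointE.
by rewrite adjointP adjointK.
Qed.

Let conjugation_linear T : linear (conjugation T).
Proof.
by move=> a S U; apply: selfadjointP => x /=; rewrite linearP.
Qed.

HB.instance Definition _ T :=
  GRing.isLinear.Build R (selfadjoint H) (selfadjoint H) *:%R (conjugation T)
    (conjugation_linear T).

End ConjugationOperator.

Definition separable (T : topologicalType) : Prop :=
  exists D : set T, countable D /\ dense D.

Definition infinite_dimensional (K : numFieldType) (X : lmodType K) : Prop :=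
  forall (n : nat) (e : 'I_n -> X),
    ~ (forall x : X, exists c : 'I_n -> K, x = \sum_(i < n) c i *: e i).

(* Unconditional convergence of the series \sum_n (u n r), uniformly in r. *)
Definition unconditionally_convergent_uniformly
    (K : numFieldType) (X : normedModType K) (u : nat -> nat -> X) : Prop :=
  forall d : K, 0 < d -> exists N : nat, forall F : {fset nat},
    (forall n, n \in F -> (N <= n)%N) ->
    forall r : nat, `|\sum_(n <- F) u n r| < d.

Definition qFHC_criterion (K : numFieldType) (X : normedModType K) (q : nat)
    (T : X -> X) : Prop :=
  exists D : set X, dense D /\ forall x, D x -> exists xs : nat -> X,
  [/\ xs 0%N = x,
      unconditionally_convergent_uniformly (fun n r =>
        if (n <= r)%N then iter (r ^ q - (r - n) ^ q) T x else 0),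
      unconditionally_convergent_uniformly (fun n r =>
        xs ((n + r) ^ q - r ^ q)%N),
      forall n : nat, iter (n ^ q) T (xs (n ^ q)%N) = x
    & forall n m : nat, (n < m)%N ->
        iter (n ^ q) T (xs (m ^ q)%N) = xs (m ^ q - n ^ q)%N].

(* The n in M with n <= N ^ q are counted from 0; this does not affect the
   positivity of the lower limit. *)
Definition q_lower_density_pos (R : realType) (q : nat) (M : set nat) : Prop :=
  (0 < limn_einf (fun N : nat =>
     ((#|[pred n : 'I_(N ^ q).+1 | `[< M (n : nat) >]]|)%:R / N%:R : R)%:E))%E.

Definition q_frequently_hypercyclic (R : realType) (E : topologicalLmodType R)
    (q : nat) (A : {linear E -> E}) : Prop :=
  continuous A /\
  exists x : E, forall V : set E, open V -> V !=set0 ->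
    q_lower_density_pos R q [set n | V (iter n A x)].

(* Main.v *)
Require Import Defs.
From HB Require Import structures.
From mathcomp Require Import all_boot all_order all_algebra finmap.
From mathcomp Require Import zify ring lra.
From mathcomp Require Import all_classical all_reals all_analysis.

Set Implicit Arguments.
Unset Strict Implicit.
Unset Printing Implicit Defensive.

Import Order.TTheory GRing.Theory Num.Theory.
Import numFieldNormedType.Exports.

Local Open Scope classical_set_scope.
Local Open Scope ring_scope.

(** Write v (x) v for the rank-one operator y |-> <y,v> v.  Conjugation by T
    sends it to (Tv) (x) (Tv), so orbits of conjugation on sums of such
    operators are governed by orbits of T on vectors.

    The key point is that in a Hilbert space unconditional convergence of a
    series of vectors forces convergence of the squares of the norms: choosing
    signs one after the other, each so that the inner product with the partial
    sum is nonnegative, gives sum |u_n|^2 <= |sum +-u_n|^2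
    ([sum_sqr_rnorm_le]).  As the norm of u (x) u is at most |u|^2, the
    unconditionally convergent series of vectors in the criterion turn into
    series of operators that converge absolutely in the operator norm,
    uniformly in the time parameter ([qFHC_summable_off_diagonal]).

    The frequently hypercyclic operator is then built as for the classical
    criterion.  Countably many targets Y_p, finite sums of operators
    +-(x (x) x) with x in a countable dense subset of D, are listed so that
    each occurs infinitely often.  Sets A_p of positive lower density are
    chosen with mutual distances so large ([separated_coloring]) that, with
    Y_(p,n) obtained from Y_p by replacing each x by its preimage of index n^q,
    the operator S = sum_p sum_(n in A_p) Y_(p,n) converges and, for m in A_p,
    the image of S under the m^q-th power of conjugation is within 2/2^p of
    Y_p in operator norm: its summand of index n = m is Y_p, and all the other
    summands together are small ([colored_sums], [near_targets]).

    It remains to see that the targets are dense for uniform convergence on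
    compact sets ([closure_signed_sums]).  If P_n are finite-rank orthogonal
    projections tending pointwise to the identity, then (U P_n + P_n U) / 2
    tends to U uniformly on compact sets, and polarization writes this
    operator as a finite signed sum of operators v (x) v, whose vectors may in
    turn be moved into the dense set.  Since every neighbourhood contains an
    operator-norm ball, an approximation in norm to infinitely many
    occurrences of a target is enough to enter any given open set. *)

(** * Separated sets of positive lower density *)

Section Positions.
Local Open Scope nat_scope.

Lemma logn2_fact_le n : logn 2 n`! <= n.
Proof.
rewrite logn_fact//.
suff /(_ n) h k : \sum_(1 <= i < k.+1) n %/ 2 ^ i + n %/ 2 ^ k <= n.
  by rewrite (leq_trans _ h)// leq_addr.
elim: k => [|k IHk]; first by rewrite big_geq// expn0 divn1.
rewrite big_nat_recr//= -addnA addnn -muln2 (leq_trans _ IHk)// leq_add2l.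
by rewrite expnSr divnMA leq_divM.
Qed.

(** Around the k-th position an interval of radius [gap k] is kept free of the
    other positions.  Large gaps are rare, and [gap] has average at most 2, so
    the positions still grow linearly. *)
Definition gap i := (logn 2 i.+1).+1.

Definition position k := \sum_(i < k) gap i + \sum_(i < k.+1) gap i.

Lemma sum_gap_le k : \sum_(i < k) gap i <= 2 * k.
Proof.
suff -> : \sum_(i < k) gap i = logn 2 k`! + k.
  by rewrite mul2n -addnn leq_add2r logn2_fact_le.
elim: k => [|k IHk]; first by rewrite big_ord0 fact0 logn1.
rewrite big_ord_recr/= IHk factS lognM ?fact_gt0// /gap; lia.
Qed.

Lemma position_le k : position k <= 4 * k.+1.
Proof.
have := sum_gap_le k; have := sum_gap_le k.+1; rewrite /position; lia.
Qed.

Lemma gap_le_position k : gap k <= position k.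
Proof. by rewrite /position [X in _ + X]big_ord_recr/= addnA leq_addl. Qed.

Lemma position_separated j k :
  j < k -> position j + gap j + gap k <= position k.
Proof.
move=> jk; rewrite /position [X in _ <= _ + X]big_ord_recr/= addnA leq_add2r.
have h : \sum_(i < j.+1) gap i <= \sum_(i < k) gap i.
  elim: k jk => // k IHk; rewrite ltnS leq_eqVlt => /predU1P[->//|/IHk h].
  by rewrite (leq_trans h)// [leqRHS]big_ord_recr/= leq_addr.
have e : \sum_(i < j.+1) gap i = \sum_(i < j) gap i + gap j.
  by rewrite big_ord_recr.
by rewrite addnAC -e leq_add.
Qed.

(** Color p is given to the k-th position when the 2-adic valuation of k+1 is
    s p, where s is strictly increasing and s p >= N p.  Such k form an
    arithmetic progression, whence the positive density, and the gap around
    the position is s p + 1, whence the separation. *)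
Lemma separated_coloring (N : nat -> nat) : exists col : nat -> option nat,
  [/\ forall n p, col n = Some p -> N p <= n,
      forall m n p r, m != n -> col m = Some p -> col n = Some r ->
        N p <= (m - n) + (n - m) /\ N r <= (m - n) + (n - m)
    & forall p, exists2 L, 0 < L &
        forall M, M %/ L <= #|[pred n : 'I_M.+1 | col n == Some p]|].
Proof.
pose s p := \sum_(i < p.+1) (N i).+1.
have sS p : s p.+1 = s p + (N p.+1).+1 by rewrite /s big_ord_recr.
have Ns p : N p <= s p by rewrite /s big_ord_recr/=; lia.
have s_mono p r : p < r -> s p < s r.
  elim: r => // r IHr; rewrite ltnS leq_eqVlt sS => /predU1P[->|/IHr]; lia.
have s_inj p r : s p = s r -> p = r.
  by case: (ltngtP p r) => // /s_mono; lia.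
have position_inj j k : position j = position k -> j = k.
  by case: (ltngtP j k) => // /position_separated; rewrite /gap; lia.
pose colored n p := exists2 k, n = position k & logn 2 k.+1 = s p.
have /choice[col colP] : forall n, exists o,
    forall p, o = Some p <-> colored n p.
  move=> n; have [[p np]|nop] := pselect (exists p, colored n p).
    exists (Some p) => r; split => [[<-]//|[k nk kr]].
    case: np nk => j -> jp /position_inj jk.
    by congr Some; apply: s_inj; rewrite -jp jk.
  by exists None => p; split => // np; case: nop; exists p.
exists col; split.
- move=> n p /colP[k -> kp].
  rewrite (leq_trans (Ns p))// (leq_trans _ (gap_le_position k))//.
  by rewrite /gap kp.
- move=> m n p r mn /colP[j mj jp] /colP[k nk kr].
  have := Ns p; have := Ns r; rewrite -jp -kr => Nr Np.
  have : j != k by apply: contraNneq mn => jk; rewrite mj nk jk.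
  by case: (ltngtP j k) => // /position_separated; rewrite -mj -nk /gap; lia.
(* the t-th k of color p is given by k + 1 = 2 ^ s p * (2 t + 1), and its
   position is at most 4 (k + 1) <= 8 * 2 ^ s p * (t + 1) *)
- move=> p; exists (8 * 2 ^ s p) => [|M]; first by rewrite muln_gt0 expn_gt0.
  set L := 8 * _; pose k t := (2 ^ s p * (2 * t).+1).-1.
  have kE t : (k t).+1 = 2 ^ s p * (2 * t).+1.
    by rewrite /k prednK// muln_gt0 expn_gt0.
  have L0 : 0 < L by rewrite muln_gt0 expn_gt0.
  have kM (t : 'I_(M %/ L)) : position (k t) < M.+1.
    rewrite ltnS (leq_trans (position_le _))// kE (@leq_trans (L * t.+1))//.
      by rewrite /L -!mulnA [leqRHS]mulnCA [leqLHS]mulnCA leq_mul2l; lia.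
    by rewrite mulnC -leq_divRL.
  pose f t := Ordinal (kM t).
  have f_inj : injective f.
    move=> t u /(congr1 val)/= /position_inj tu; apply: val_inj.
    have := kE t; rewrite tu kE => /eqP.
    rewrite eqn_pmul2l ?expn_gt0// => /eqP/= ?; lia.
  rewrite -{1}(card_ord (M %/ L)) -(card_codom f_inj) subset_leq_card//.
  apply/fintype.subsetP => _ /codomP[t ->]; rewrite inE; apply/eqP/colP.
  exists (k t) => //=; rewrite kE lognM ?expn_gt0// pfactorK//.
  by rewrite logn_coprime ?addn0// coprime2n/= mul2n odd_double.
Qed.

End Positions.

Section Assembly.
Variable R : realType.

(** In [g m n], m is a time and n the index of a summand; the tails are taken
    away from n = m, so they contain both the summands whose time has passed
    and those whose time is still to come. *)
Definition summable_off_diagonal (g : nat -> nat -> R) :=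
  forall d, 0 < d -> exists N, forall m (s : seq nat), uniq s ->
    (forall n, n \in s -> (N <= (m - n) + (n - m))%N) ->
    \sum_(n <- s) g m n <= d.

Lemma summable_off_diagonal0 :
  summable_off_diagonal (fun _ _ => 0).
Proof. by move=> d d0; exists 0%N => m s _ _; rewrite big1// ltW. Qed.

Lemma summable_off_diagonalD (f g : nat -> nat -> R) :
  summable_off_diagonal f -> summable_off_diagonal g ->
  summable_off_diagonal (fun m n => f m n + g m n).
Proof.
move=> hf hg d d0; have d20 : 0 < d / 2 by rewrite divr_gt0.
have [Nf NfP] := hf _ d20; have [Ng NgP] := hg _ d20.
exists (maxn Nf Ng) => m s us sN; rewrite big_split [leRHS]splitr.
by apply: lerD; [apply: NfP|apply: NgP] => // n /sN; rewrite geq_max => /andP[].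
Qed.

Lemma summable_off_diagonal_sum (I : Type) (s : seq I)
    (f : I -> nat -> nat -> R) :
  (forall i, summable_off_diagonal (f i)) ->
  summable_off_diagonal (fun m n => \sum_(i <- s) f i m n).
Proof.
move=> fs; elim: s => [|i s IHs].
  rewrite (_ : (fun _ _ => _) = fun _ _ => 0).
    exact: summable_off_diagonal0.
  by apply/funext => m; apply/funext => n; rewrite big_nil.
rewrite (_ : (fun _ _ => _) = fun m n => f i m n + \sum_(i <- s) f i m n).
  exact: summable_off_diagonalD.
by apply/funext => m; apply/funext => n; rewrite big_cons.
Qed.

Lemma sum_geometric_le2 K : \sum_(0 <= p < K) (2 ^- p : R) <= 2.
Proof.
suff -> : \sum_(0 <= p < K) (2 ^- p : R) = 2 - 2 * 2 ^- K.
  by rewrite gerBl mulr_ge0// invr_ge0 exprn_ge0.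
elim: K => [|K IHK]; first by rewrite big_geq// expr0 invr1 mulr1 subrr.
rewrite big_nat_recr//= IHK exprS; field; exact: expf_neq0.
Qed.

(** The separation [N p] is chosen so that beyond it the sums of [g r], for all
    r <= p, are at most 2 ^- (r + p).  Two indices of colors p and r are
    separated by N (maxn r p), so the indices of color r contribute at most
    2 ^- r * 2 ^- p to a sum around an index m of color p, and the geometric
    series takes care of the sum over r. *)
Lemma colored_sums (g : nat -> nat -> nat -> R) :
  (forall p, summable_off_diagonal (g p)) ->
  exists col : nat -> option nat,
  [/\ forall K, \sum_(0 <= n < K) oapp (fun p => g p 0%N n) 0 (col n) <= 2,
      forall K m p, col m = Some p ->
        \sum_(0 <= n < K | n != m) oapp (fun r => g r m n) 0 (col n)
          <= 2 * 2 ^- p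
    & forall p, exists2 L, (0 < L)%N & forall M,
        (M %/ L <= #|[pred n : 'I_M.+1 | col n == Some p]|)%N].
Proof.
move=> gs.
have dpos (k : nat) : (0 : R) < 2 ^- k by rewrite invr_gt0 exprn_gt0.
have /choice[Nf NfP] : forall rp : nat * nat, exists N,
    forall m (s : seq nat), uniq s ->
    (forall n, n \in s -> (N <= (m - n) + (n - m))%N) ->
    \sum_(n <- s) g rp.1 m n <= 2 ^- (rp.1 + rp.2).
  by move=> [r p]; exact: gs.
pose N p := (\sum_(r < p.+1) (Nf (r : nat, p)).+1)%N.
have pN p : (p < N p)%N.
  have : (\sum_(r < p.+1) 1 <= N p)%N by apply: leq_sum.
  by rewrite sum1_card card_ord.
have NfN r p : (r <= p)%N -> (Nf (r, p) <= N p)%N.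
  move=> rp; rewrite /N (bigD1 (Ordinal (rp : (r < p.+1)%N)))//=; lia.
have [col [colN colS colD]] := separated_coloring N.
have colK K n p : (n < K)%N -> col n = Some p -> (p < K)%N.
  by move=> nK /colN pn; rewrite (leq_trans (pN p))// (leq_trans pn)// ltnW.
have split_colors K m P c : 0 <= c ->
    (forall r, \sum_(0 <= n < K | P n && (col n == Some r)) g r m n
       <= c * 2 ^- r) ->
    \sum_(0 <= n < K | P n) oapp (fun r => g r m n) 0 (col n) <= 2 * c.
  move=> c0 h.
  suff -> : \sum_(0 <= n < K | P n) oapp (fun r => g r m n) 0 (col n) =
      \sum_(0 <= r < K) \sum_(0 <= n < K | P n && (col n == Some r)) g r m n.
    rewrite (le_trans (ler_sum _ (fun r _ => h r)))// -mulr_sumr mulrC.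
    by rewrite ler_wpM2r// sum_geometric_le2.
  under [RHS]eq_bigr do rewrite big_mkcondr.
  rewrite exchange_big/= big_nat_cond [RHS]big_nat_cond.
  apply: eq_bigr => n /andP[/andP[_ nK] Pn].
  case coln : (col n) => [p|] /=; last by rewrite big1.
  rewrite (bigD1_seq p) ?mem_index_iota ?iota_uniq ?(colK _ _ _ nK coln)//=.
  rewrite eqxx big1 ?addr0// => r rp.
  by rewrite (inj_eq Some_inj) eq_sym (negbTE rp).
exists col; split => //.
- move=> K; rewrite -[leRHS]mulr1; apply: split_colors => // r.
  rewrite -big_filter.
  rewrite (le_trans (NfP (r, r) _ _ _ _)) ?filter_uniq ?iota_uniq//=.
    move=> n; rewrite mem_filter => /andP[/eqP/colN rn _].
    by rewrite sub0n subn0 (leq_trans (NfN _ _ _) rn).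
  by rewrite mul1r lef_pV2 ?posrE ?exprn_gt0// ler_eXn2l ?ltr1n// leq_addr.
- move=> K m p mp; apply: split_colors => [|r]; first exact/ltW.
  rewrite -big_filter -invfM -exprD addnC.
  pose t := maxn r p.
  rewrite (le_trans (NfP (r, t) _ _ _ _)) ?filter_uniq ?iota_uniq//=.
    move=> n; rewrite mem_filter => /andP[/andP[nm /eqP nr] _].
    rewrite eq_sym in nm; have [Np Nr] := colS _ _ _ _ nm mp nr.
    rewrite (leq_trans (NfN _ _ (leq_maxl _ _)))//.
    by rewrite /t; case: (leqP r p).
  by rewrite lef_pV2 ?posrE ?exprn_gt0// ler_eXn2l ?ltr1n// leq_add2l leq_maxr.
Qed.

End Assembly.

(** * Squares of norms in unconditionally convergent series *)

Section Norms.
Variables (R : realType) (k : scalar_kind) (H : hilbertType R k).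
Local Notation K := (scalars R k).
Implicit Types (x y : H) (c : R).

Lemma norm_le_real x c : (`|x| <= real_scalar c :> K) = (rnorm x <= c).
Proof. by rewrite -real_rnorm real_scalar_le. Qed.

Lemma norm_lt_real x c : (`|x| < real_scalar c :> K) = (rnorm x < c).
Proof. by rewrite -real_rnorm real_scalar_lt. Qed.

Lemma rnormN x : rnorm (- x) = rnorm x.
Proof. by rewrite /rnorm normrN. Qed.

Lemma rnorm0 : rnorm (0 : H) = 0.
Proof. by rewrite /rnorm normr0 -(real_scalar0 R k) scalar_Re_real. Qed.

Lemma rnorm_eq0 x : (rnorm x == 0) = (x == 0).
Proof.
apply/eqP/eqP => [x0|->]; last exact: rnorm0.
by apply/eqP; rewrite -normr_eq0 -real_rnorm x0 real_scalar0.
Qed.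

Lemma rnormD_le x y : rnorm (x + y) <= rnorm x + rnorm y.
Proof.
by rewrite -norm_le_real real_scalarD !real_rnorm ler_normD.
Qed.

Lemma rnormB_le x y : rnorm (x - y) <= rnorm x + rnorm y.
Proof. by rewrite -(rnormN y) rnormD_le. Qed.

Lemma rnorm_sum_le (I : Type) (s : seq I) (P : pred I) (f : I -> H) :
  rnorm (\sum_(i <- s | P i) f i) <= \sum_(i <- s | P i) rnorm (f i).
Proof.
elim/big_rec2: _ => [|i a x _ xa]; first by rewrite rnorm0.
by rewrite (le_trans (rnormD_le _ _))// lerD2l.
Qed.

Lemma rnorm_scale (a : K) x : rnorm (a *: x) = scalar_Re `|a| * rnorm x.
Proof.
by rewrite /rnorm normrZ -{1}(scalar_Re_ge0 (normr_ge0 a)) scalar_ReZ.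
Qed.

Lemma rnorm_rank1 x y : rnorm (inner y x *: x) <= rnorm x ^+ 2 * rnorm y.
Proof.
rewrite rnorm_scale expr2 -mulrA mulrC ler_wpM2l ?rnorm_ge0//.
rewrite -(real_scalar_le k) real_scalarM scalar_Re_ge0// !real_rnorm mulrC.
exact: inner_le.
Qed.

(** Going through [s], the sign of each vector is chosen so that its inner
    product with the signed sum of the others is nonnegative. *)
Lemma sum_sqr_rnorm_le (f : nat -> H) (s : seq nat) : exists F G,
  [/\ subseq F s, subseq G s &
    \sum_(n <- s) rnorm (f n) ^+ 2 <=
      rnorm (\sum_(n <- F) f n - \sum_(n <- G) f n) ^+ 2].
Proof.
elim: s => [|n s [F [G [Fs Gs h]]]].
  by exists [::], [::]; split => //; rewrite !big_nil sqr_ge0.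
set X := _ - _ in h.
have [p|p] := leP 0 (scalar_Re (inner (f n) X)).
  exists (n :: F), G; split; first by rewrite /= eqxx.
    by rewrite (subseq_trans Gs)// subseq_cons.
  rewrite !big_cons -addrA -/X addrC rnormD2; move: h p; lra.
exists F, (n :: G); split; last 2 first.
- by rewrite /= eqxx.
- rewrite !big_cons opprD addrCA addrC rnormD2 -/X rnormN innerNl.
  by rewrite scalar_ReN; move: h p; lra.
- by rewrite (subseq_trans Fs)// subseq_cons.
Qed.

(** A signed sum over a finite set is the difference of two of its subsums, so
    a bound on all subsums bounds the signed sum, hence the sum of squares. *)
Lemma unconditional_sqr_summable (u : nat -> nat -> H) :
  unconditionally_convergent_uniformly u ->
  forall d : R, 0 < d -> exists N, forall r (s : seq nat), uniq s ->
    (forall n, n \in s -> (N <= n)%N) ->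
    \sum_(n <- s) rnorm (u n r) ^+ 2 <= d.
Proof.
move=> uu d d0; pose e := Num.sqrt d / 2.
have e0 : 0 < e by rewrite divr_gt0// sqrtr_gt0.
have [N NP] : exists N, forall F : {fset nat},
    (forall n, n \in F -> (N <= n)%N) ->
    forall r, `|\sum_(n <- F) u n r| < (real_scalar e : K).
  by apply: uu; rewrite -(real_scalar0 R k) real_scalar_lt.
exists N => r s us sN.
have small F : subseq F s -> rnorm (\sum_(n <- F) u n r) <= e.
  move=> Fs; rewrite -norm_le_real ltW//.
  have FE : perm_eq F [fset n in F]%fset.
    apply: uniq_perm; [exact: subseq_uniq us|exact: fset_uniq|].
    by move=> n; rewrite inE.
  rewrite (perm_big _ FE); apply: NP => n; rewrite inE => nF.
  by apply: sN; apply: (mem_subseq Fs).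
have [F [G [Fs Gs h]]] := sum_sqr_rnorm_le (u^~ r) s.
rewrite (le_trans h)// -[leRHS]sqr_sqrtr ?(ltW d0)//.
rewrite ler_sqr ?nnegrE ?rnorm_ge0 ?sqrtr_ge0//.
rewrite (le_trans (rnormB_le _ _))//.
rewrite (le_trans (lerD (small _ Fs) (small _ Gs)))//.
by rewrite /e -splitr.
Qed.

(** At time m, the summand of index n <= m is [iter (m ^ q - n ^ q) T x], a term
    of the first series of the criterion with r = m, and the summand of index
    n > m is [xs (n ^ q - m ^ q)], a term of the second. *)
Lemma qFHC_summable_off_diagonal (q : nat) (T : H -> H) (x : H)
    (xs : nat -> H) :
  xs 0%N = x ->
  unconditionally_convergent_uniformly (fun n r =>
    if (n <= r)%N then iter (r ^ q - (r - n) ^ q) T x else 0) ->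
  unconditionally_convergent_uniformly
    (fun n r => xs ((n + r) ^ q - r ^ q)%N) ->
  (forall n, iter (n ^ q) T (xs (n ^ q)%N) = x) ->
  (forall n m, (n < m)%N ->
     iter (n ^ q) T (xs (m ^ q)%N) = xs (m ^ q - n ^ q)%N) ->
  summable_off_diagonal
    (fun m n => rnorm (iter (m ^ q) T (xs (n ^ q)%N)) ^+ 2).
Proof.
move=> x0 ha hb hc hd d d0; have d20 : 0 < d / 2 by rewrite divr_gt0.
have [Na NaP] := unconditional_sqr_summable ha d20.
have [Nb NbP] := unconditional_sqr_summable hb d20.
exists (maxn Na Nb) => m s us sN.
rewrite (bigID (fun n => (n <= m)%N))/= [leRHS]splitr lerD//.
- apply: le_trans (NaP m [seq (m - n)%N | n <- s & (n <= m)%N] _ _);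
    last 2 first.
  + rewrite map_inj_in_uniq ?filter_uniq// => i j.
    by rewrite !mem_filter => /andP[im _] /andP[jm _]; lia.
  + move=> j /mapP[n]; rewrite mem_filter => /andP[nm /sN] h ->; lia.
  rewrite big_map big_filter; apply: ler_sum => n nm.
  rewrite leq_subr (subKn nm).
  have nmq : (n ^ q <= m ^ q)%N by case: (q) => // q1; rewrite leq_exp2r.
  by rewrite -{1}(subnK nmq) iterD hc.
- apply: le_trans (NbP m [seq (n - m)%N | n <- s & (m < n)%N] _ _);
    last 2 first.
  + rewrite map_inj_in_uniq ?filter_uniq// => i j.
    by rewrite !mem_filter => /andP[im _] /andP[jm _]; lia.
  + move=> j /mapP[n]; rewrite mem_filter => /andP[nm /sN] h ->; lia.
  rewrite big_map big_filter; under eq_bigl do rewrite -ltnNge.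
  by apply: ler_sum => n nm; rewrite subnK ?(ltnW nm)// hd.
Qed.

End Norms.

(** * Rank-one operators and conjugation *)

Section RankOne.
Variables (R : realType) (k : scalar_kind) (H : hilbertType R k).
Local Notation K := (scalars R k).
Implicit Types (x y : H) (S : selfadjoint H) (T : bounded_operator H).

Program Definition rank1_op x :=
  @BoundedOperator R k H (fun y => inner y x *: x) _ _.
Next Obligation.
by move=> x a y z; rewrite innerDl innerZl scalerDl scalerA.
Qed.
Next Obligation.
move=> x; exists (real_scalar (rnorm x ^+ 2)) => y.
by rewrite -(real_rnorm y) -real_scalarM norm_le_real rnorm_rank1.
Qed.

Program Definition rank1 x := @SelfAdjoint R k H (rank1_op x) _.
Next Obligation.
move=> x; apply: adjoint_unique => y z /=.
by rewrite innerZl innerZr -innerC mulrC.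
Qed.

(** A positive coefficient can be absorbed into the vector, so signs are the
    only coefficients that real combinations of rank-one operators need. *)
Definition signed_rank1 (b : bool) x : selfadjoint H :=
  if b then rank1 x else - rank1 x.

Definition signed_sum (I : Type) (phi : I -> H) (c : seq (bool * I)) :
    selfadjoint H :=
  \sum_(bi <- c) signed_rank1 bi.1 (phi bi.2).

Definition op_le S (M : R) := forall y, rnorm (S y) <= M * rnorm y.

Lemma sa_oppE S y : (- S) y = - S y.
Proof.
rewrite -[LHS]/(real_scalar (-1) *: S y) -[- 1]sub0r real_scalarB real_scalar0.
by rewrite real_scalar1 sub0r scaleN1r.
Qed.

Lemma sa_sumE (I : Type) (s : seq I) (P : pred I) (F : I -> selfadjoint H) y :
  (\sum_(i <- s | P i) F i) y = \sum_(i <- s | P i) F i y.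
Proof. by elim/big_rec2: _ => // i a S _ <-. Qed.

Lemma op_le_signed_rank1 b x : op_le (signed_rank1 b x) (rnorm x ^+ 2).
Proof. by case: b => y; rewrite ?sa_oppE ?rnormN rnorm_rank1. Qed.

Lemma op_le_sum (I : Type) (s : seq I) (P : pred I) (F : I -> selfadjoint H) M :
  (forall i, P i -> op_le (F i) (M i)) ->
  op_le (\sum_(i <- s | P i) F i) (\sum_(i <- s | P i) M i).
Proof.
move=> FM y; rewrite sa_sumE (le_trans (rnorm_sum_le _ _ _))// mulr_suml.
by apply: ler_sum => i Pi; exact: FM.
Qed.

Lemma op_le_signed_sum (I : Type) (phi : I -> H) (c : seq (bool * I)) :
  op_le (signed_sum phi c) (\sum_(bi <- c) rnorm (phi bi.2) ^+ 2).
Proof. by apply: op_le_sum => bi _; exact: op_le_signed_rank1. Qed.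

Lemma conjugation_rank1 T x : conjugation T (rank1 x) = rank1 (T x).
Proof.
apply: selfadjointP => y; rewrite /= linearZ/=.
by rewrite -[adjoint_fun T y]/(adjoint T y) adjointP adjointK.
Qed.

Lemma iter_conjugationE n T S y :
  iter n (conjugation T) S y = iter n T (S (iter n (adjoint T) y)).
Proof.
by elim: n y => // n IHn y; rewrite iterS/= IHn -iterSr.
Qed.

Lemma conjugation_signed_rank1 T b x :
  conjugation T (signed_rank1 b x) = signed_rank1 b (T x).
Proof. by case: b; rewrite /= ?raddfN/= conjugation_rank1. Qed.

Lemma iter_conjugation_signed_sum n T (I : Type) (phi : I -> H) c :
  iter n (conjugation T) (signed_sum phi c) = signed_sum (iter n T \o phi) c.
Proof.
elim: n => // n IHn; rewrite iterS IHn /signed_sum raddf_sum.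
by apply: eq_bigr => bi _; rewrite /= conjugation_signed_rank1.
Qed.

End RankOne.

(** * Limits and series of operators *)

Section Limits.
Variables (R : realType) (k : scalar_kind) (H : hilbertType R k).
Local Notation K := (scalars R k).
Implicit Types (x y z : H) (S : selfadjoint H) (T : bounded_operator H).

Lemma real_scalar_gt0 (e : R) : (0 < real_scalar e :> K) = (0 < e).
Proof. by rewrite -(real_scalar0 R k) real_scalar_lt. Qed.

Lemma nbhs_rnorm_lt x (e : R) : 0 < e -> \forall y \near x, rnorm (x - y) < e.
Proof.
move=> e0; have : 0 < (real_scalar e : K) by rewrite real_scalar_gt0.
move=> /(nbhsx_ballx x); apply: filterS => y.
by rewrite -ball_normE /ball_/= norm_lt_real.
Qed.

Lemma cvg_rnormP (X : Type) (F : set_system X) (f : X -> H) x : Filter F ->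
  f @ F --> x <-> forall e : R, 0 < e -> \forall t \near F, rnorm (x - f t) < e.
Proof.
move=> FF; split => [/cvgrPdist_lt h e e0|h].
  have {}h := h (real_scalar e).
  apply: filterS (h _); last by rewrite real_scalar_gt0.
  by move=> t; rewrite norm_lt_real.
apply/cvgrPdist_lt => e e0; have eE := scalar_Re_ge0 (ltW e0).
have : 0 < scalar_Re e by rewrite -real_scalar_gt0 eE.
by move=> /h; apply: filterS => t; rewrite -norm_lt_real eE.
Qed.

Lemma bop_bound T : exists2 M : R, 0 < M & forall x, rnorm (T x) <= M * rnorm x.
Proof.
have [M M0 TM] := bop_ge0_bounded T; exists (M + 1); first by rewrite ltr_wpDl.
move=> x; have := TM x; rewrite -(real_rnorm x) -real_scalarM norm_le_real.
by move=> /le_trans; apply; rewrite ler_wpM2r ?rnorm_ge0// lerDl.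
Qed.

Lemma bop_continuous T : continuous T.
Proof.
have [M M0 TM] := bop_bound T => x; apply/cvg_rnormP => e e0.
have : 0 < e / M by rewrite divr_gt0.
move=> /(nbhs_rnorm_lt x); apply: filterS => y xy.
by rewrite -linearB (le_lt_trans (TM _))// mulrC -ltr_pdivlMr.
Qed.

Lemma additive_bounded_continuous (f : H -> K) (C : R) :
  (forall x y, f (x - y) = f x - f y) -> 0 <= C ->
  (forall x, `|f x| <= real_scalar C * `|x|) -> continuous f.
Proof.
move=> fB C0 fC x; apply/cvgrPdist_lt => e e0.
have eE := scalar_Re_ge0 (ltW e0).
have {}e0 : 0 < scalar_Re e by rewrite -real_scalar_gt0 eE.
have C1 : 0 < C + 1 by rewrite ltr_wpDl.
have : 0 < scalar_Re e / (C + 1) by rewrite divr_gt0.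
move=> /(nbhs_rnorm_lt x); apply: filterS => y xy.
rewrite -fB (le_lt_trans (fC _))// -real_rnorm -real_scalarM -eE real_scalar_lt.
move: xy; rewrite ltr_pdivlMr// mulrC => /le_lt_trans; apply.
by rewrite ler_wpM2r ?rnorm_ge0// lerDl.
Qed.

Lemma inner_continuousl y : continuous (inner ^~ y).
Proof.
apply: (@additive_bounded_continuous _ (rnorm y)); rewrite ?rnorm_ge0// => x.
  by move=> z; rewrite innerDl innerNl.
by rewrite real_rnorm mulrC inner_le.
Qed.

Lemma inner_continuousr x : continuous (inner x).
Proof.
apply: (@additive_bounded_continuous _ (rnorm x)); rewrite ?rnorm_ge0// => y.
  by move=> z; rewrite innerDr innerNr.
by rewrite real_rnorm inner_le.
Qed.

Lemma iter_bop_continuous T n : continuous (iter n T).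
Proof.
elim: n => [|n IHn] x; first exact: cvg_id.
by apply: continuous_comp; [exact: IHn|exact: bop_continuous].
Qed.

Lemma rnorm_lim_le (f : nat -> H) x y (c : R) :
  f n @[n --> \oo] --> x -> (\forall n \near \oo, rnorm (f n - y) <= c) ->
  rnorm (x - y) <= c.
Proof.
move=> /cvg_rnormP fx fc; apply/ler_addgt0Pr => e /fx fe.
have [n [xn ny]] := filter_ex (filterI fe fc).
rewrite -(subrKA (f n)) (le_trans (rnormD_le _ _))// addrC lerD//; exact: ltW.
Qed.

(** The partial sums are Cauchy at each vector by absolute convergence;
    linearity, the bound and self-adjointness pass to the pointwise limit. *)
Lemma selfadjoint_series (Z : nat -> selfadjoint H) (b : nat -> R) (B : R) :
  (forall n, op_le (Z n) (b n)) -> (forall n, 0 <= b n) ->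
  (forall N, \sum_(0 <= n < N) b n <= B) ->
  exists S, forall y, \sum_(0 <= n < N) Z n y @[N --> \oo] --> S y.
Proof.
move=> Zb b0 bB.
have cb : cvgn (series b).
  apply: nondecreasing_is_cvgn.
    apply/nondecreasing_seqP => n.
    by rewrite !seriesEnat/= big_nat_recr//= lerDl.
  by exists B => _ [N _ <-]; rewrite seriesEnat; exact: bB.
have /choice[s sP] : forall y, exists z,
    \sum_(0 <= n < N) Z n y @[N --> \oo] --> z.
  move=> y; suff : cauchy (series (fun n => Z n y) @ \oo).
    by move=> /cauchy_cvg/cvg_ex[l]; rewrite seriesEnat; exists l.
  apply/cauchy_seriesP => e e0; have eE := scalar_Re_ge0 (ltW e0).
  have e0' : 0 < scalar_Re e by rewrite -real_scalar_gt0 eE.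
  have y0 : 0 < rnorm y + 1 by rewrite ltr_wpDl// rnorm_ge0.
  have : cauchy (series b @ \oo) by exact: cvg_cauchy.
  move=> /cauchy_seriesP/(_ (scalar_Re e / (rnorm y + 1)) (divr_gt0 e0' y0)).
  apply: filterS => -[m n]/= bmn; rewrite -eE norm_lt_real.
  rewrite (le_lt_trans (rnorm_sum_le _ _ _))//.
  rewrite (@le_lt_trans _ _ ((\sum_(m <= i < n) b i) * rnorm y))//.
    by rewrite mulr_suml; apply: ler_sum => i _; exact: Zb.
  move: bmn; rewrite ger0_norm ?sumr_ge0// ltr_pdivlMr// => /le_lt_trans; apply.
  by rewrite ler_wpM2l ?lerDl// sumr_ge0.
have slin : linear s.
  move=> a x y; apply: (cvg_unique (@norm_hausdorff _ H) (sP (a *: x + y))).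
  have -> : (fun N => \sum_(0 <= n < N) Z n (a *: x + y)) =
      (fun N => a *: \sum_(0 <= n < N) Z n x + \sum_(0 <= n < N) Z n y).
    apply/funext => N; rewrite scaler_sumr -big_split/=.
    by apply: eq_bigr => n _; rewrite linearP.
  by apply: cvgD; [apply: cvgZr; exact: sP|exact: sP].
have sB y : rnorm (s y) <= B * rnorm y.
  rewrite -[s y]subr0; apply: (rnorm_lim_le (sP y)).
  apply: nearW => N; rewrite subr0.
  rewrite (le_trans (rnorm_sum_le _ _ _))//.
  rewrite (@le_trans _ _ (\sum_(0 <= n < N) b n * rnorm y))//.
    by apply: ler_sum => n _; exact: Zb.
  by rewrite -mulr_suml ler_wpM2r ?rnorm_ge0.
have sbound : exists M : K, forall x, `|s x| <= M * `|x|.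
  exists (real_scalar B) => x.
  rewrite -(real_rnorm x) -real_scalarM norm_le_real.
  exact: sB.
pose s1 := BoundedOperator slin sbound.
have s1P : adjoint s1 = s1.
  apply: adjoint_unique => x y /=.
  have lx := continuous_cvg eventually_filter
    (@inner_continuousl y (s x)) (sP x).
  have ly := continuous_cvg eventually_filter
    (@inner_continuousr x (s y)) (sP y).
  apply: (cvg_unique (@norm_hausdorff _ (scalars R k)) lx).
  rewrite (_ : _ \o _ = inner x \o (fun N => \sum_(0 <= n < N) Z n y))//.
  by apply/funext => N /=; rewrite -!sa_sumE selfadjointE.
by exists (SelfAdjoint s1P).
Qed.


End Limits.

(** * Uniform convergence on compact sets *)

Section CompactOpenTopology.
Variables (R : realType) (k : scalar_kind) (H : hilbertType R k).
Local Notation K := (scalars R k).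
Implicit Types (x y z : H) (S : selfadjoint H) (T : bounded_operator H).

Lemma cot_cvg (F : set_system (selfadjoint H)) S : Filter F ->
  (forall (A : set H) (e : R), compact A -> 0 < e ->
     F [set T : selfadjoint H | forall y, A y -> rnorm (S y - T y) < e]) ->
  F --> S.
Proof.
move=> FF h.
pose w (T : selfadjoint H) : {family compact, H -> H} := T : H -> H.
have wS : w @ F --> w S.
  apply/fam_cvgP => A cA P /uniform_nbhs[E []].
  rewrite -entourage_ballE => -[e /= e0 eE] EP.
  rewrite /= nbhs_simpl/=; have eRe := scalar_Re_ge0 (ltW e0).
  have Re0 : 0 < scalar_Re e by rewrite -(real_scalar_gt0 k) eRe.
  apply: filterS (h A _ cA Re0) => T ST; apply: EP => y Ay; apply: eE => /=.
  by rewrite -ball_normE /ball_/= -eRe norm_lt_real; exact: ST.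
move=> U; rewrite /= (@nbhsE (initial_topology w)) => -[V [[W oW <-] WS] VU].
by apply: filterS VU _; apply: wS; apply: open_nbhs_nbhs.
Qed.

(** A compact set is bounded, so the topology is coarser than that of the
    operator norm. *)
Lemma cot_nbhs_op_le S (V : set (selfadjoint H)) : nbhs S V ->
  exists2 e : R, 0 < e & forall T : selfadjoint H,
    (forall y, rnorm (T y - S y) <= e * rnorm y) -> V T.
Proof.
pose near_op (e : R) :=
  [set T : selfadjoint H | forall y, rnorm (T y - S y) <= e * rnorm y].
pose F := filter_from [set e : R | 0 < e] near_op.
have FF : Filter F.
  apply: filter_from_filter; first by exists 1 => /=.
  move=> e f /= e0 f0; exists (Num.min e f); first by rewrite /= lt_min e0.
  move=> T h; split => y; rewrite (le_trans (h y))//.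
    by rewrite ler_wpM2r ?rnorm_ge0// ge_min lexx.
  by rewrite ler_wpM2r ?rnorm_ge0// ge_min lexx orbT.
suff FS : F --> S by move=> /FS[e e0 eV]; exists e => // T Te; exact: eV.
apply: cot_cvg => A e cA e0; have [M M0 AM] := compact_rnorm cA.
exists (e / M) => /=; first by rewrite divr_gt0.
move=> T h y Ay; rewrite -rnormN opprB (le_lt_trans (h y))//.
by rewrite mulrAC ltr_pdivrMr// ltr_pM2l// AM.
Qed.

Lemma conjugation_continuous T : continuous (conjugation T).
Proof.
have [M M0 TM] := bop_bound T => S; apply: cot_cvg => [|A e cA e0].
  exact/fmap_filter/nbhs_filter.
have cB : compact (adjoint T @` A).
  apply: continuous_compact cA; apply: continuous_subspaceT.
  exact: bop_continuous.
apply: filterS (cot_nbhs S cB (divr_gt0 e0 M0)) => U SU y Ay.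
rewrite /= -linearB (le_lt_trans (TM _))// mulrC -ltr_pdivlMr//.
by rewrite -(norm_lt_real _ (e / M)); apply: SU; exists y.
Qed.

Lemma signed_rank1_continuous b : continuous (@signed_rank1 R k H b).
Proof.
move=> v; apply: cot_cvg => A e cA e0; have [M M0 AM] := compact_rnorm cA.
pose C := M * (2 * rnorm v + 1).
have C0 : 0 < C by rewrite mulr_gt0// ltr_wpDl// mulr_ge0// rnorm_ge0.
have d0 : 0 < Num.min 1 (e / C) by rewrite lt_min ltr01 divr_gt0.
apply: filterS (nbhs_rnorm_lt v d0) => w; rewrite lt_min => /andP[vw1 vw] y Ay.
have -> : rnorm (signed_rank1 b v y - signed_rank1 b w y) =
    rnorm (inner y v *: v - inner y w *: w).
  by case: b => //; rewrite /signed_rank1 !sa_oppE -opprD rnormN.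
have -> : inner y v *: v - inner y w *: w =
    inner y (v - w) *: v + inner y w *: (v - w).
  by rewrite innerDr innerNr scalerBl scalerBr addrA subrK.
have inner_rnorm (x z u : H) :
    rnorm (inner x z *: u) <= rnorm x * rnorm z * rnorm u.
  rewrite rnorm_scale ler_wpM2r ?rnorm_ge0// -(real_scalar_le k).
  by rewrite real_scalarM scalar_Re_ge0// !real_rnorm inner_le.
rewrite (le_lt_trans (rnormD_le _ _))//.
rewrite (le_lt_trans (lerD (inner_rnorm _ _ _) (inner_rnorm _ _ _)))//.
have wv : rnorm w <= rnorm v + 1.
  rewrite -[w](subKr v) (le_trans (rnormB_le _ _))// lerD2l ltW//.
have -> : rnorm y * rnorm (v - w) * rnorm v +
      rnorm y * rnorm w * rnorm (v - w) =
    rnorm (v - w) * (rnorm y * (rnorm v + rnorm w)) by ring.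
move: vw; rewrite ltr_pdivlMr// => /le_lt_trans; apply.
rewrite ler_wpM2l ?rnorm_ge0// /C ler_pM ?addr_ge0 ?rnorm_ge0//.
  by rewrite ltW ?AM.
by move: wv; lra.
Qed.

End CompactOpenTopology.

(** * Density of the signed sums of rank-one operators *)

Section Density.
Variables (R : realType) (k : scalar_kind) (H : hilbertType R k).
Local Notation K := (scalars R k).
Implicit Types (x y z : H) (S : selfadjoint H) (us : seq H).

Definition rank1_sum us : selfadjoint H := \sum_(u <- us) rank1 u.

Lemma rank1_sum_cons u us y :
  rank1_sum (u :: us) y = inner y u *: u + rank1_sum us y.
Proof. by rewrite /rank1_sum big_cons. Qed.

(** The vector added at each step is the normalized residual of [d n] for the
    projection built so far, unless this residual is 0; it is orthogonal to the
    range of that projection. *)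
Lemma gram_schmidt (d : nat -> H) n : exists us,
  (forall y, rank1_sum us (rank1_sum us y) = rank1_sum us y) /\
  (forall j, (j < n)%N -> rank1_sum us (d j) = d j).
Proof.
elim: n => [|n [us [usK us_d]]].
  by exists [::]; split => // y; rewrite /rank1_sum big_nil.
pose P := rank1_sum us; pose w := d n - P (d n).
have Pw : P w = 0 by rewrite /w linearB/= usK subrr.
have [w0|w0] := eqVneq w 0.
  exists us; split => // j; rewrite ltnS leq_eqVlt => /predU1P[->|/us_d//].
  by apply/esym/eqP; rewrite -subr_eq0 -/w w0.
pose r := rnorm w; have r0 : r != 0 by rewrite rnorm_eq0.
pose c : K := real_scalar r^-1; pose u := c *: w.
have Pu : P u = 0 by rewrite /u linearZ/= Pw scaler0.
have Pu0 y : inner (P y) u = 0 by rewrite selfadjointE Pu raddf0.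
have cw : inner w u = real_scalar r.
  rewrite /u innerZr scalar_conj_real inner_norm -real_rnorm expr2.
  by rewrite -!real_scalarM -/r mulrA mulVf// mul1r.
have cr : c * real_scalar r = 1.
  by rewrite -real_scalarM mulVf// real_scalar1.
have uu : inner u u = 1 by rewrite {1}/u innerZl cw cr.
exists (u :: us); split => [y|j].
  rewrite !rank1_sum_cons -/P innerDl innerZl uu mulr1 Pu0 addr0; congr (_ + _).
  by rewrite linearD linearZ/= -/P Pu scaler0 add0r usK.
rewrite ltnS rank1_sum_cons -/P leq_eqVlt => /predU1P[->|/us_d jd].
  have dE : d n = w + P (d n) by rewrite subrK.
  by rewrite {1}dE innerDl Pu0 addr0 cw /u scalerA mulrC cr scale1r -dE.
by rewrite -{1}jd Pu0 scale0r add0r.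
Qed.

Lemma idempotent_contraction S : (forall y, S (S y) = S y) ->
  forall y, rnorm (S y) <= rnorm y.
Proof.
move=> SK y; have [->|Sy0] := eqVneq (rnorm (S y)) 0; first exact: rnorm_ge0.
rewrite -(@ler_pM2l _ (rnorm (S y))) ?lt_def ?Sy0 ?rnorm_ge0//.
by rewrite -expr2 -Re_innerxx -{1}selfadjointE SK Re_inner_le.
Qed.

(** The projections are eventually the identity at each vector of a dense
    sequence, and they are contractions: pointwise convergence follows, and
    the contraction bound makes it uniform near each point. *)
Lemma projections_cvg_compact (d : nat -> H) (P : nat -> selfadjoint H)
    (A : set H) (e : R) :
  (forall x (f : R), 0 < f -> exists j, rnorm (x - d j) < f) ->
  (forall n y, P n (P n y) = P n y) ->
  (forall n j, (j < n)%N -> P n (d j) = d j) ->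
  compact A -> 0 < e ->
  \forall n \near \oo, forall y, A y -> rnorm (y - P n y) < e.
Proof.
move=> dd PK Pd /compact_near_coveringP cA e0.
apply: (cA nat \oo (fun n y => rnorm (y - P n y) < e)) => x Ax.
have e4 : 0 < e / 4 by rewrite divr_gt0.
have [j xj] := dd x _ e4.
exists ([set y | rnorm (x - y) < e / 4], [set n | (j < n)%N]).
  by split; [exact: nbhs_rnorm_lt|exists j.+1].
move=> [y n] [/= xy jn].
have yd : rnorm (y - d j) < e / 2.
  rewrite -(subrKA x) (le_lt_trans (rnormD_le _ _))//.
  by rewrite -(opprB x y) rnormN; lra.
rewrite -(subrKA (d j)) -{2}(Pd _ _ jn) -linearB.
rewrite (le_lt_trans (rnormD_le _ _))//.
have := idempotent_contraction (PK n) (d j - y).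
rewrite -(opprB y) rnormN; move: yd; lra.
Qed.

Definition half : K := real_scalar 2^-1.

Lemma half_half : half + half = 1.
Proof.
by rewrite /half -real_scalarD -(real_scalar1 R k); congr real_scalar; lra.
Qed.

(** With P the projection [rank1_sum us], this is (S P + P S) / 2, written as a
    signed sum of rank-one operators by polarization: for a = S u,
    a (x) u + u (x) a is half the difference of (a + u) (x) (a + u) and
    (a - u) (x) (a - u). *)
Definition symmetrized S us : selfadjoint H :=
  signed_sum id (flatten
    [seq [:: (true, half *: (S u + u)); (false, half *: (S u - u))] | u <- us]).

Lemma symmetrizedE S us y :
  symmetrized S us y = half *: (S (rank1_sum us y) + rank1_sum us (S y)).
Proof.
elim: us => [|u us IHus].
  by rewrite /symmetrized /rank1_sum /signed_sum !big_nil linear0 addr0 scaler0.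
rewrite !rank1_sum_cons [S (_ + _)]linearD/= linearZ/= addrACA.
rewrite [RHS]scalerDr -IHus.
rewrite /symmetrized /= /signed_sum !big_cons addrA.
congr (_ + _).
rewrite -[LHS]/(inner y (half *: (S u + u)) *: (half *: (S u + u)) +
  signed_rank1 false (half *: (S u - u)) y) sa_oppE.
rewrite selfadjointE /= !innerZr !innerDr innerNr !scalar_conj_real -/half.
set a := S u; set p := inner y a; set r := inner y u.
rewrite !scalerA.
rewrite !scalerDr scalerN opprD opprK addrACA -scalerBl -scalerDl !scalerA.
have -> : half * (p + r) * half - half * (p - r) * half =
  half * r * (half + half) by ring.
have -> : half * (p + r) * half + half * (p - r) * half =
  half * p * (half + half) by ring.
by rewrite half_half !mulr1.
Qed.

Variable d : nat -> H.
Hypothesis d_dense : forall x (f : R), 0 < f -> exists j, rnorm (x - d j) < f.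

Let G := range (@signed_sum R k H nat d).

Let closureG_add S U : closure G S -> closure G U -> closure G (S + U).
Proof.
move=> GS GU B /(@add_continuous _ (S, U))[[/= B1 B2] [SB1 UB2] B12].
have [_ [[c1 _ <-] B1c]] := GS _ SB1.
have [_ [[c2 _ <-] B2c]] := GU _ UB2.
exists (signed_sum d (c1 ++ c2)); split; first by exists (c1 ++ c2).
rewrite /signed_sum big_cat; exact: (B12 (_, _) (conj B1c B2c)).
Qed.

Let closureG_rank1 b v : closure G (signed_rank1 b v).
Proof.
move=> B /(@signed_rank1_continuous R k H b v)/nbhs_ballP[e /= e0 eB].
have eE := scalar_Re_ge0 (ltW e0).
have {}e0 : 0 < scalar_Re e by rewrite -(real_scalar_gt0 k) eE.
have [j vj] := d_dense v e0.
exists (signed_rank1 b (d j)); split.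
  by exists [:: (b, j)] => //; rewrite /signed_sum big_seq1.
by apply: eB; rewrite -ball_normE /ball_/= -eE norm_lt_real.
Qed.

Let closureG_signed_sum (I : Type) (phi : I -> H) c :
  closure G (signed_sum phi c).
Proof.
elim: c => [|[b i] c IHc].
  by apply: subset_closure; exists [::] => //; rewrite /signed_sum !big_nil.
rewrite /signed_sum big_cons; apply: closureG_add IHc; exact: closureG_rank1.
Qed.

(** The closure is stable under addition and contains all signed rank-one
    operators, hence all symmetrizations of S, which tend to S. *)
Lemma closure_signed_sums S : closure (range (@signed_sum R k H nat d)) S.
Proof.
have /choice[us usP] := gram_schmidt d.
pose P n := rank1_sum (us n).
have PK n y : P n (P n y) = P n y by case: (usP n) => + _; apply.
have Pd n j : (j < n)%N -> P n (d j) = d j by case: (usP n) => _; apply.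
have : symmetrized S (us n) @[n --> \oo] --> S.
  apply: cot_cvg => A e cA e0.
  have [M M0 SM] := bop_bound S.
  have cSA : compact (S @` A).
    apply: continuous_compact cA; apply: continuous_subspaceT.
    exact: bop_continuous.
  have h1 := projections_cvg_compact d_dense PK Pd cA (divr_gt0 e0 M0).
  have h2 := projections_cvg_compact d_dense PK Pd cSA e0.
  apply: filterS2 h1 h2 => n h1 h2 y Ay /=.
  rewrite symmetrizedE -/(P n).
  rewrite -{1}[S y]scale1r -{1}half_half scalerDl -scalerDr -scalerBr.
  rewrite opprD addrACA -linearB.
  rewrite rnorm_scale /half real_scalar_norm scalar_Re_real ger0_norm//.
  rewrite mulrC ltr_pdivrMr// mulr_natr mulr2n.
  rewrite (le_lt_trans (rnormD_le _ _))// ltrD//.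
    by rewrite (le_lt_trans (SM _))// mulrC -ltr_pdivlMr// h1.
  by apply: h2; exists y.
apply: (@closed_cvg _ _ _ _ _ (closure G)); first exact: closed_closure.
by apply: nearW => n; exact: closureG_signed_sum.
Qed.

End Density.

(** * Lower densities and enumerations *)

(** Since m |-> m ^ q is injective, [M] has at least N %/ L elements up to
    N ^ q, and N %/ L >= N / (2 L) as soon as N >= L. *)
Lemma q_lower_density_pos_powers (R : realType) (q L : nat) (M : set nat)
    (B : pred nat) :
  (0 < q)%N -> (0 < L)%N ->
  (forall N, (N %/ L <= #|[pred n : 'I_N.+1 | B n]|)%N) ->
  (forall m, B m -> M (m ^ q)%N) ->
  q_lower_density_pos R q M.
Proof.
move=> q0 L0 BL BM; rewrite /q_lower_density_pos.
set u := fun N : nat => _.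
have count N : (N %/ L <= #|[pred n : 'I_(N ^ q).+1 | `[< M n >]]|)%N.
  rewrite (leq_trans (BL N))//.
  have lt_pow (i : 'I_N.+1) : (i ^ q < (N ^ q).+1)%N.
    by rewrite ltnS leq_exp2r// -ltnS.
  pose f i := Ordinal (lt_pow i).
  have f_inj : injective f.
    by move=> i j /(congr1 val)/= /eqP; rewrite eqn_exp2r// => /eqP/val_inj.
  rewrite -(fintype.card_image f_inj) subset_leq_card//.
  apply/fintype.subsetP => _ /fintype.imageP[i Bi ->].
  by move: Bi; rewrite !inE => /BM.
suff : ((2 * L%:R)^-1%:E <= limn_einf u)%E.
  by apply: lt_le_trans; rewrite lte_fin invr_gt0 mulr_gt0// ltr0n.
rewrite limn_einf_lim; apply: lime_ge; first exact: is_cvg_einfs.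
exists L => // n /= Ln; apply: le_ereal_inf_tmp => _ [N /= nN <-].
rewrite lee_fin ler_pdivlMr ?ltr0n ?(leq_trans L0) ?(leq_trans Ln)//.
rewrite mulrC ler_pdivrMr ?mulr_gt0 ?ltr0n//.
rewrite (@le_trans _ _ ((N %/ L)%:R * (2 * L%:R)))//.
  rewrite -!natrM ler_nat; have := divn_eq N L; have := ltn_pmod N L0.
  have : (0 < N %/ L)%N by rewrite divn_gt0// (leq_trans Ln).
  nia.
by rewrite ler_wpM2r ?mulr_ge0// ler_nat count.
Qed.

Lemma injective_nat_unbounded (f : nat -> nat) : injective f ->
  forall n, exists j, (n <= f j)%N.
Proof.
move=> f_inj n; apply: contrapT => /forallNP h.
have fn (i : 'I_n.+1) : (f i < n)%N by rewrite ltnNge; apply/negP/h.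
have g_inj : injective (fun i => Ordinal (fn i)).
  by move=> i j /(congr1 val)/= /f_inj/val_inj.
by have := leq_card _ g_inj; rewrite !card_ord ltnn.
Qed.

(** Pairs of an element and an integer are enumerated, and the integer is
    forgotten. *)
Lemma recurrent_enumeration (C : countType) : exists c : nat -> option C,
  forall x n, exists2 p, (n <= p)%N & c p = Some x.
Proof.
exists (fun p : nat => omap fst (@choice.unpickle (C * nat)%type p)) => x n.
have [|j nj] := @injective_nat_unbounded (fun j => choice.pickle (x, j)) _ n.
  by move=> i j /(pcan_inj choice.pickleK)[].
by exists (choice.pickle (x, j)) => //; rewrite choice.pickleK.
Qed.

Section DenseSequences.
Variables (R : realType) (k : scalar_kind) (H : hilbertType R k).

Lemma dense_rnorm (D : set H) : dense D ->
  forall x (e : R), 0 < e -> exists2 z, D z & rnorm (x - z) < e.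
Proof.
move=> Dd x e e0.
have xe := nbhs_rnorm_lt x e0.
have [|z [/interior_subset xz Dz]] :=
  Dd _ _ (open_interior [set y | rnorm (x - y) < e]).
  by exists x; exact: xe.
by exists z.
Qed.

(** A countable dense subset need not meet [D]; each of its points is replaced
    by points of [D] at distances tending to 0. *)
Lemma dense_sequence (D : set H) : separable H -> dense D ->
  exists d : nat -> H, (forall n, D (d n)) /\
    forall x (e : R), 0 < e -> exists j, rnorm (x - d j) < e.
Proof.
move=> [E [/countable_injP[f f_inj] Ed]] Dd.
have /choice[g gP] : forall ni : nat * nat, exists z, D z /\
    forall y, E y -> f y = ni.1 -> rnorm (y - z) < ni.2.+1%:R^-1.
  move=> [n i] /=; have [[y [Ey fy]]|noy] := pselect (exists y, E y /\ f y = n).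
    have [|z Dz yz] := @dense_rnorm _ Dd y (i.+1%:R^-1).
      by rewrite invr_gt0.
    exists z; split=> // y' Ey' fy'.
    by rewrite (_ : y' = y)//; apply: f_inj; rewrite ?inE// fy fy'.
  have [z Dz _] := dense_rnorm Dd 0 ltr01.
  by exists z; split => // y Ey fy; case: noy; exists y.
exists (fun m => g (odflt (0, 0)%N (choice.unpickle m))); split => [n|x e e0].
  by have [] := gP (odflt (0, 0)%N (choice.unpickle n)).
have e20 : 0 < e / 2 by rewrite divr_gt0.
have [y Ey xy] := dense_rnorm Ed x e20.
pose i := Num.truncn (e / 2)^-1.
exists (choice.pickle (f y, i)); rewrite choice.pickleK/=.
have [_ /(_ y Ey erefl)/= yz] := gP (f y, i).
rewrite -(subrKA y) (le_lt_trans (rnormD_le _ _))// [ltRHS]splitr ltrD//.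
rewrite (lt_trans yz)// invf_plt ?posrE ?ltr0n//.
by rewrite /i truncnS_gt.
Qed.

End DenseSequences.

(** * Frequent hypercyclicity of conjugation *)

Section Hypercyclicity.
Variables (R : realType) (k : scalar_kind) (H : hilbertType R k).
Implicit Types (x y : H) (T : bounded_operator H).

(** For q = 0 the exponents r ^ 0 - (r - n) ^ 0 all vanish, so the n-th term of
    the first series of the criterion is x itself, which must then be 0: the
    dense set is reduced to 0, and so is the space. *)
Lemma qFHC_criterion_gt0 (q : nat) T :
  infinite_dimensional H -> qFHC_criterion q T -> (0 < q)%N.
Proof.
move=> Hinf [D [Dd DP]]; rewrite lt0n; apply/eqP => q0.
have D0 x : D x -> x = 0.
  move=> /DP[_ [_ ha _ _ _]]; apply/eqP; rewrite -rnorm_eq0.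
  apply/eqP/le_anti; rewrite rnorm_ge0 andbT; apply/ler_addgt0Pr => e e0.
  have [|N /(_ [fset N]%fset)] := ha (real_scalar e).
    by rewrite real_scalar_gt0.
  have h : forall n, n \in [fset N]%fset -> (N <= n)%N.
    by move=> n; rewrite inE => /eqP->.
  move=> /(_ h N); rewrite big_seq_fset1 leqnn q0 !expn0 subnn/=.
  rewrite norm_lt_real add0r.
  exact: ltW.
apply: (Hinf 0%N (fun=> 0)) => x; exists (fun=> 0); rewrite big_ord0.
apply/eqP; rewrite -rnorm_eq0; apply/eqP/le_anti; rewrite rnorm_ge0 andbT.
apply/ler_addgt0Pr => e /(dense_rnorm Dd x)[z /D0 ->]; rewrite subr0 add0r.
exact: ltW.
Qed.

(** The operator is the sum over all n of the sum of signed rank-one operators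
    for the target given by the color of n, with the vectors [X i (n ^ q)] in
    place of [d i]; it converges by the case m = 0 of the estimates.  At time
    m ^ q the summand of index m becomes the target of the color of m. *)
Lemma near_targets (q : nat) T (d : nat -> H) (X : nat -> nat -> H)
    (c : nat -> seq (bool * nat)) :
  (0 < q)%N ->
  (forall i, summable_off_diagonal
    (fun m n => rnorm (iter (m ^ q) T (X i (n ^ q)%N)) ^+ 2)) ->
  (forall i m, iter (m ^ q) T (X i (m ^ q)%N) = d i) ->
  exists S : selfadjoint H, exists2 col : nat -> option nat,
    forall m p, col m = Some p -> forall y,
      rnorm (iter (m ^ q) (conjugation T) S y - signed_sum d (c p) y) <=
        2 * 2 ^- p * rnorm y
  & forall p, exists2 L, (0 < L)%N & forall M,
      (M %/ L <= #|[pred n : 'I_M.+1 | col n == Some p]|)%N.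
Proof.
move=> q0 Xs XT.
pose g p m n := \sum_(bi <- c p) rnorm (iter (m ^ q) T (X bi.2 (n ^ q)%N)) ^+ 2.
have gs p : summable_off_diagonal (g p) by exact: summable_off_diagonal_sum.
have g0 p m n : 0 <= g p m n by apply: sumr_ge0 => bi _; exact: sqr_ge0.
have [col [col2 colp colD]] := colored_sums gs.
pose Z n : selfadjoint H :=
  oapp (fun p => signed_sum (fun i => X i (n ^ q)%N) (c p)) 0 (col n).
have ZT m n : iter (m ^ q) (conjugation T) (Z n) = oapp (fun p =>
    signed_sum (iter (m ^ q) T \o (fun i => X i (n ^ q)%N)) (c p)) 0 (col n).
  rewrite /Z; case: (col n) => [p|] /=.
    exact: iter_conjugation_signed_sum.
  by elim: (m ^ q)%N => // j /= ->; rewrite linear0.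
have ZTle m n : op_le (iter (m ^ q) (conjugation T) (Z n))
    (oapp (fun p => g p m n) 0 (col n)).
  rewrite ZT; case: (col n) => [p|] /=; first exact: op_le_signed_sum.
  by move=> y; rewrite rnorm0 mul0r.
have [S SP] : exists S : selfadjoint H,
    forall y, \sum_(0 <= n < N) Z n y @[N --> \oo] --> S y.
  apply: (@selfadjoint_series _ _ _ Z
    (fun n => oapp (fun p => g p 0%N n) 0 (col n)) 2) => //.
    by move=> n; have := ZTle 0%N n; rewrite exp0n.
  by move=> n; case: (col n) => /=.
exists S, col => // m p mp y.
pose U N : selfadjoint H :=
  \sum_(0 <= n < N) iter (m ^ q) (conjugation T) (Z n).
have US : U N y @[N --> \oo] --> iter (m ^ q) (conjugation T) S y.
  rewrite iter_conjugationE.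
  rewrite (_ : (fun N => U N y) = iter (m ^ q) T \o
    (fun N => \sum_(0 <= n < N) Z n (iter (m ^ q) (adjoint T) y))).
    exact: continuous_cvg (@iter_bop_continuous _ _ _ _ _ _) (SP _).
  apply/funext => N; rewrite /U sa_sumE /=.
  have iterD j : {morph iter j T : u v / u + v}.
    by elim: j => // j IHj u v; rewrite /= IHj linearD.
  have iter0 j : iter j T 0 = 0 by elim: j => // j /= ->; rewrite linear0.
  rewrite (big_morph _ (iterD (m ^ q)%N) (iter0 (m ^ q)%N)).
  by apply: eq_bigr => n _; rewrite iter_conjugationE.
apply: (rnorm_lim_le US); exists m.+1 => // N /= mN.
have -> : U N y - signed_sum d (c p) y =
    (\sum_(0 <= n < N | n != m) iter (m ^ q) (conjugation T) (Z n)) y.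
  rewrite /U (bigD1_seq m) ?mem_index_iota ?iota_uniq//= ZT mp /= addrAC.
  rewrite (_ : signed_sum (_ \o _) _ = signed_sum d (c p)) ?subrr ?add0r//.
  by congr signed_sum; apply/funext => i /=; exact: XT.
have := @op_le_sum _ _ _ _ (index_iota 0 N) (fun n => n != m) _ _
  (fun n _ => ZTle m n) y.
move=> /le_trans; apply.
by rewrite ler_wpM2r ?rnorm_ge0//; exact: colp.
Qed.

Lemma exists_geometric_le (e : R) : 0 < e ->
  exists n, forall p, (n <= p)%N -> 2 * 2 ^- p <= e.
Proof.
move=> e0; exists (Num.truncn (2 / e)).+1 => p np.
rewrite ler_pdivrMr ?exprn_gt0// mulrC -ler_pdivrMr// ltW//.
rewrite (lt_le_trans (truncnS_gt _))// (@le_trans _ _ p%:R) ?ler_nat//.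
by rewrite -natrX ler_nat ltnW// ltn_expl.
Qed.

End Hypercyclicity.

Theorem proposition3p13 (R : realType) (k : scalar_kind) (H : hilbertType R k)
    (q : nat) (T : bounded_operator H) :
  separable H ->
  infinite_dimensional H ->
  qFHC_criterion q T ->
  q_frequently_hypercyclic q (conjugation T : {linear selfadjoint H -> selfadjoint H}).
Proof.
move=> Hsep Hinf HT; split; first exact: conjugation_continuous.
have q0 := qFHC_criterion_gt0 Hinf HT.
have [D [Dd DP]] := HT; have [d [dD d_dense]] := dense_sequence Hsep Dd.
have /choice[X XP] := fun i => DP _ (dD i).
have [c cP] := recurrent_enumeration (seq (bool * nat) : countType).
have Xs i : summable_off_diagonal
    (fun m n => rnorm (iter (m ^ q) T (X i (n ^ q)%N)) ^+ 2).
  have [X0 ha hb hc hd] := XP i.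
  exact: (qFHC_summable_off_diagonal X0 ha hb hc hd).
have XT i m : iter (m ^ q) T (X i (m ^ q)%N) = d i by have [] := XP i.
have [S [col Scol colD]] := near_targets (fun p => odflt [::] (c p)) q0 Xs XT.
exists S => V oV [S0 VS0].
have [_ [[a _ <-] Va]] :=
  closure_signed_sums d_dense (open_nbhs_nbhs (conj oV VS0)).
have [e e0 eV] := cot_nbhs_op_le (open_nbhs_nbhs (conj oV Va)).
have [n nP] := exists_geometric_le e0; have [p np pa] := cP a n.
have [L L0 LP] := colD p.
apply: (q_lower_density_pos_powers R (B := fun n => col n == Some p) q0 L0 LP).
move=> m /eqP mp; apply: eV => y.
have := Scol _ _ mp y; rewrite pa /= => /le_trans; apply.
by rewrite ler_wpM2r ?rnorm_ge0// nP.
Qed.
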